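(* Let $\lambda$ be a partition. For any integer $n\ge 0$, there is a bijection between the set of pairs of reverse plane partitions $(\Lambda,\Lambda')\in\mathrm{RPP}(\lambda)\times\mathrm{RPP}(\lambda)$ satisfying $g(\Lambda,\Lambda')=0$ and having total volume $|\Lambda|+|\Lambda'|=n$, and the set of reverse plane partitions of shape $\lambda$ and volume $n$.
   Context: Partitions and RPPs. $\lambda=(\lambda_1\ge\dots\ge\lambda_\ell>0)$ is an integer partition, $\ell=\ell(\lambda)$, $\lambda'$ is the conjugate partition. The cells of $\lambda$ are the pairs $(i,j)$ with $1\le i\le \ell$, $1\le j\le\lambda_i$ ($i$ is the row, numbered from the bottom, $j$ the column). A reverse plane partition (RPP) of shape $\lambda$ is a map $\Lambda$ from the cells of $\lambda$ to the non-negative integers that is weakly increasing in $i$ and weakly increasing in $j$. $\mathrm{RPP}(\lambda)$ is the set of these, and $|\Lambda|$ (the volume) is the sum of the entries. Conventions: $\Lambda(i,0)=\Lambda(0,j)=0$. Coupled pairs. View an RPP as a stack of $\Lambda(i,j)$ unit cubes over each cell $(i,j)$, in an infinitely tall room whose back wall follows the boundary of $\lambda$, seen from the corner of small $i,j$; this gives a lozenge tiling. A point $(u,v,h)$ ($u$ in the row direction index $i$, $v$ in the column direction index $j$, $h$ height) is projected to horizontal coordinate $v-u$ and vertical coordinate $h+(u+v)/2$. The picture is cut into vertical slices $[d,d+1]$, $d=-\ell,\dots,\lambda_1-1$. A slice $d$ is a hole slice if $d\in H=\{j-1-\lambda'_j:1\le j\le\lambda_1\}$ and a particle slice if $d\in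 D=\{\lambda_i-i:1\le i\le \ell\}$ ($H$ and $D$ partition $\{-\ell,\dots,\lambda_1-1\}$). There are three lozenge types: top faces of stacks; ''left'' faces, separating $(i,j-1)$ from $(i,j)$; ''right'' faces, separating $(i-1,j)$ from $(i,j)$. Recording each lozenge, up to a shift depending only on $d$, by the vertical position of the unit vertical segment at horizontal coordinate $d+1$ (the right edge of a left or right face in slice $d$, or the short diagonal of a top face centred at $d+1$), set - for $d\in H$: $O_d(\Lambda)=\{h+i : (i,j)\in\lambda,\ j-i=d+1,\ h\in\mathbb Z,\ \Lambda(i,j-1)<h\le\Lambda(i,j)\}$ (left faces in slice $d$); - for $d\in D$: $B_d(\Lambda)=\{h+i : (i,j)\in\lambda,\ j-i=d,\ h\in\mathbb Z,\ \Lambda(i-1,j)<h\le\Lambda(i,j)\}$ (right faces in slice $d$); - for all $d$: $T_d(\Lambda)=\{\Lambda(i,j)+i+1 : (i,j)\in\lambda,\ j-i=d+1\}$ (top faces). When the tilings of $\Lambda$ (''blue'') and $\Lambda'$ (''red'') are superimposed, a coupled pair is one of: (type 1) in a hole slice, a blue left face whose right edge is the short diagonal of a red top face; (type 2) in a hole slice, a blue and a red left face in the same position; (type 3) in a particle slice, a blue and a red right face in the same position; (type 4) in a particle slice, a red right face whose right edge is the short diagonal of a blue top face. Then $g(\Lambda,\Lambda')$ is the number of coupled pairs, i.e. $$g(\Lambda,\Lambda')=\sum_{d\in H}\big(|O_d(\Lambda)\cap T_d(\Lambda')|+|O_d(\Lambda)\cap O_d(\Lambda')|\big)+\sum_{d\in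 D}\big(|B_d(\Lambda)\cap B_d(\Lambda')|+|T_d(\Lambda)\cap B_d(\Lambda')|\big).$$ *)

(* Defs.v *)
From HB Require Import structures.
From mathcomp Require Import all_boot all_order all_algebra.
From mathcomp Require Import finmap.

Set Implicit Arguments.
Unset Strict Implicit.
Unset Printing Implicit Defensive.

Import Order.TTheory GRing.Theory Num.Theory.

(* The empty sequence is the empty partition. *)
Definition is_partition (la : seq nat) : bool := sorted geq la && (0 \notin la).

Definition conj_part (la : seq nat) (j : nat) : nat := count (leq j) la.

(* Cells are numbered from 1, whereas [nth] counts from 0. *)
Definition is_cell (la : seq nat) (i j : nat) : bool :=
  (1 <= i <= size la) && (1 <= j <= nth 0 la i.-1).

(* [head 0 la] is the largest part, so the two ordinal bounds exclude no cell;
   they only make the type of cells finite. *)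
Definition cell (la : seq nat) : Type :=
  {c : 'I_(size la).+1 * 'I_(head 0 la).+1 | is_cell la c.1 c.2}.

HB.instance Definition _ (la : seq nat) := SubFinite.on (cell la).

Definition crow (la : seq nat) (c : cell la) : nat := (val c).1.
Definition ccol (la : seq nat) (c : cell la) : nat := (val c).2.

Definition is_rpp (la : seq nat) (L : {ffun cell la -> nat}) : bool :=
  [forall c : cell la, forall c' : cell la,
     ((crow c <= crow c') && (ccol c == ccol c') ==> (L c <= L c')) &&
     ((crow c == crow c') && (ccol c <= ccol c') ==> (L c <= L c'))].

Record rpp (la : seq nat) : Type := Rpp {
  rpp_val :> {ffun cell la -> nat};
  _ : is_rpp rpp_val
}.

HB.instance Definition _ (la : seq nat) := [isSub for @rpp_val la].
HB.instance Definition _ (la : seq nat) := [Choice of rpp la by <:].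

Definition volume (la : seq nat) (L : rpp la) : nat := \sum_(c : cell la) L c.

(* L(i, j), extended by 0 off the shape; in particular L(i, 0) = L(0, j) = 0. *)
Definition entry (la : seq nat) (L : rpp la) (i j : nat) : nat :=
  if [pick c : cell la | (crow c == i) && (ccol c == j)] is Some c then L c
  else 0.

(* Rows and columns are subtracted in [int], since contents may be negative. *)
Definition diag (la : seq nat) (e : int) : seq (cell la) :=
  [seq c <- enum {: cell la} | ((ccol c)%:Z - (crow c)%:Z == e)%R].

Definition hole_slices (la : seq nat) : {fset int} :=
  [fset x in [seq (j%:Z - 1 - (conj_part la j)%:Z)%R
             | j <- index_iota 1 (head 0 la).+1]]%fset.

Definition particle_slices (la : seq nat) : {fset int} :=
  [fset x in [seq ((nth 0 la i.-1)%:Z - i%:Z)%R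
             | i <- index_iota 1 (size la).+1]]%fset.

(* In the next two definitions the range is a < h <= b with 0 <= a, so letting
   h range over [nat] loses no integer h. *)
Definition left_faces (la : seq nat) (d : int) (L : rpp la) : {fset nat} :=
  [fset x in [seq (h + crow c)%N
             | c <- diag la (d + 1)%R,
               h <- index_iota (entry L (crow c) (ccol c).-1).+1
                               (entry L (crow c) (ccol c)).+1]]%fset.

Definition right_faces (la : seq nat) (d : int) (L : rpp la) : {fset nat} :=
  [fset x in [seq (h + crow c)%N
             | c <- diag la d,
               h <- index_iota (entry L (crow c).-1 (ccol c)).+1
                               (entry L (crow c) (ccol c)).+1]]%fset.

Definition top_faces (la : seq nat) (d : int) (L : rpp la) : {fset nat} :=
  [fset x in [seq (entry L (crow c) (ccol c) + crow c + 1)%N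
             | c <- diag la (d + 1)%R]]%fset.

Definition coupled_pairs (la : seq nat) (L L' : rpp la) : nat :=
  \sum_(d <- hole_slices la)
     (#|` (left_faces d L `&` top_faces d L')%fset |
      + #|` (left_faces d L `&` left_faces d L')%fset |)
  + \sum_(d <- particle_slices la)
     (#|` (right_faces d L `&` right_faces d L')%fset |
      + #|` (top_faces d L `&` right_faces d L')%fset |).

(* Main.v *)
Require Import Defs.
From HB Require Import structures.
From mathcomp Require Import all_boot all_order all_algebra.
From mathcomp Require Import finmap.
From mathcomp Require Import zify.

Set Implicit Arguments.
Unset Strict Implicit.
Unset Printing Implicit Defensive.

(** A reverse plane partition is a chain of partitions, one per diagonal, in
  which hole slices add a horizontal strip and particle slices remove one.  Put
  row [r] of the blue (resp. red) partition at the position [2 (part + r)]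
  (resp. [2 (part + r) + 1]) of a common line.  A slice moves every particle,
  and it has no coupled pair exactly when the closed intervals swept by a blue
  and a red particle are disjoint or the blue particle (in a hole slice), resp.
  the red one (in a particle slice), stands still.

  Fix the states [b] and [c] around a peak [b -> a -> c] of such a chain, and let
  [hi] and [lo] be the maximum and minimum of [b] and [c].  The admissible peaks
  [a] are described by independent constraints: [a p] runs from [hi p] up to
  the next interval [[lo q, hi q]] on the line, whatever its colour.  Dually an
  admissible valley [g] runs from [lo q] down to the previous interval.  Matching
  the two ends of every gap between intervals turns a peak into a valley
  together with a natural number, the free move of the topmost particle, and the
  sum of the sizes of [a] and [g] is determined by [b], [c] and that number.

  The same argument applies to one colour.  Flattening peaks one at a time ends
  at the constant chain in both cases, so the chains of one colour and those of
  two colours are parametrised by the same set, with the same total size on each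
  diagonal. *)

(* Two particles of colours [cp], [cq] move between [xp <= yp] and [xq <= yq]; [e] is
   the colour (blue is [false]) allowed to be passed over while standing still. *)
Definition pair_ok (e cp cq : bool) (xp yp xq yq : nat) : bool :=
  [|| yp < xq, yq < xp, [&& cp == e, cq != e & xp == yp]
    | [&& cq == e, cp != e & xq == yq]].

(** This decouples the particles: on the right, two conditions concern the fixed neighbours alone,
    one concerns [ap] and one concerns [aq], so a peak may be chosen particle by particle. *)
Lemma pair_ok_above (kp kq : bool) (bp cp ap bq cq aq : nat) :
  maxn bp cp <= ap -> maxn bq cq <= aq ->
  pair_ok false kp kq bp ap bq aq && pair_ok true kp kq cp ap cq aq =
  [&& pair_ok false kp kq bp (maxn bp cp) bq (maxn bq cq),
      pair_ok true kp kq cp (maxn bp cp) cq (maxn bq cq),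
      [|| ap == maxn bp cp, maxn bq cq < maxn bp cp | ap < minn bq cq]
    & [|| aq == maxn bq cq, maxn bp cp < maxn bq cq | aq < minn bp cp]].
Proof. by rewrite /pair_ok; case: kp; case: kq => /=; lia. Qed.

(** Though valleys lie below the minima, the conditions on the neighbours are written with maxima so
    as to be literally those of [pair_ok_above]. *)
Lemma pair_ok_below (kp kq : bool) (bp cp gp bq cq gq : nat) :
  gp <= minn bp cp -> gq <= minn bq cq ->
  pair_ok true kp kq gp bp gq bq && pair_ok false kp kq gp cp gq cq =
  [&& pair_ok false kp kq bp (maxn bp cp) bq (maxn bq cq),
      pair_ok true kp kq cp (maxn bp cp) cq (maxn bq cq),
      [|| gp == minn bp cp, minn bp cp < minn bq cq | maxn bq cq < gp]
    & [|| gq == minn bq cq, minn bq cq < minn bp cp | maxn bp cp < gq]].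
Proof. by rewrite /pair_ok; case: kp; case: kq => /=; lia. Qed.

(** * Peaks and valleys between two fixed neighbours *)

Section LocalMove.

Variables (P : finType) (col : P -> bool).
Implicit Types (x y a b c g : {ffun P -> nat}).

Definition strip (e : bool) x y : bool :=
  [forall p, [&& x p <= y p, odd (x p) == col p & odd (y p) == col p]] &&
  [forall p, forall q, (p != q) ==>
     pair_ok e (col p) (col q) (x p) (y p) (x q) (y q)].

Lemma stripP e x y : reflect
  ((forall p, [/\ x p <= y p, odd (x p) = col p & odd (y p) = col p]) /\
   (forall p q, p != q -> pair_ok e (col p) (col q) (x p) (y p) (x q) (y q)))
  (strip e x y).
Proof.
apply: (iffP andP) => -[h1 h2]; split.
- by move=> p; move/forallP/(_ p)/and3P: h1 => [? /eqP ? /eqP ?].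
- by move=> p q npq; move/forallP/(_ p)/forallP/(_ q)/implyP: h2; apply.
- by apply/forallP => p; case: (h1 p) => -> -> ->; rewrite !eqxx.
- by apply/forallP => p; apply/forallP => q; apply/implyP; apply: h2.
Qed.

Definition hi b c : {ffun P -> nat} := [ffun p => maxn (b p) (c p)].
Definition lo b c : {ffun P -> nat} := [ffun p => minn (b p) (c p)].

(** This is admissibility of the lowest candidate [hi b c] for a peak. By [aboveP] and [belowP], no
    peak and no valley exists when it fails. *)
Definition compat b c : bool := strip false b (hi b c) && strip true c (hi b c).

Definition above b c a : Prop :=
  forall p, [/\ hi b c p <= a p, odd (a p) = col p &
    a p = hi b c p \/ forall q, q != p -> (hi b c q < hi b c p) || (a p < lo b c q)].

Definition below b c g : Prop :=
  forall p, [/\ g p <= lo b c p, odd (g p) = col p &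
    g p = lo b c p \/ forall q, q != p -> (lo b c p < lo b c q) || (hi b c q < g p)].

Lemma aboveP b c a :
  (strip false b a && strip true c a) <-> (compat b c /\ above b c a).
Proof.
split.
- case/andP => /stripP[h1 h2] /stripP[h3 h4].
  have hM p : maxn (b p) (c p) <= a p by case: (h1 p); case: (h3 p); lia.
  have kk p q (npq : p != q) := esym (pair_ok_above (col p) (col q) (hM p) (hM q)).
  split.
  + apply/andP; split; apply/stripP; split => p.
    * rewrite !ffunE; case: (h1 p); case: (h3 p) => *; split => //; first by lia.
      by rewrite /maxn; case: ifP.
    * move=> q npq; move: (kk p q npq); rewrite h2 // h4 // !ffunE.
      by move=> /and4P[].
    * rewrite !ffunE; case: (h1 p); case: (h3 p) => *; split => //; first by lia.
      by rewrite /maxn; case: ifP.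
    * move=> q npq; move: (kk p q npq); rewrite h2 // h4 // !ffunE.
      by move=> /and4P[].
  + move=> p; rewrite !ffunE; split; [exact: hM | by case: (h1 p)|].
    case: (eqVneq (a p) (maxn (b p) (c p))) => [->|ne]; first by left.
    right => q nqp; rewrite !ffunE.
    have npq : p != q by rewrite eq_sym.
    move: (kk p q npq); rewrite h2 // h4 //= => /and4P[_ _].
    by rewrite (negbTE ne).
- case=> /andP[/stripP[h1 h2] /stripP[h3 h4]] hA.
  have hM p : maxn (b p) (c p) <= a p by case: (hA p); rewrite ffunE.
  have key p q (npq : p != q) :
    pair_ok false (col p) (col q) (b p) (a p) (b q) (a q) &&
    pair_ok true (col p) (col q) (c p) (a p) (c q) (a q).
    rewrite pair_ok_above //.
    move: (h2 p q npq) (h4 p q npq); rewrite !ffunE => -> -> /=.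
    have nqp : q != p by rewrite eq_sym.
    apply/andP; split.
    + case: (hA p) => _ _; rewrite !ffunE => -[->|/(_ q nqp)]; rewrite ?eqxx //.
      by rewrite !ffunE => ->; rewrite orbT.
    + case: (hA q) => _ _; rewrite !ffunE => -[->|/(_ p npq)]; rewrite ?eqxx //.
      by rewrite !ffunE => ->; rewrite orbT.
  apply/andP; split; apply/stripP; split.
  + by move=> p; case: (h1 p); case: (hA p); move: (hM p) => *; split => //; lia.
  + by move=> p q /key /andP[].
  + by move=> p; case: (h3 p); case: (hA p); move: (hM p) => *; split => //; lia.
  + by move=> p q /key /andP[].
Qed.

Lemma belowP b c g :
  (strip true g b && strip false g c) <-> (compat b c /\ below b c g).
Proof.
split.
- case/andP => /stripP[h1 h2] /stripP[h3 h4].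
  have hm p : g p <= minn (b p) (c p) by case: (h1 p); case: (h3 p); lia.
  have kk p q (npq : p != q) := esym (pair_ok_below (col p) (col q) (hm p) (hm q)).
  split.
  + apply/andP; split; apply/stripP; split => p.
    * rewrite !ffunE; case: (h1 p); case: (h3 p) => *; split => //; first by lia.
      by rewrite /maxn; case: ifP.
    * move=> q npq; move: (kk p q npq); rewrite h2 // h4 // !ffunE.
      by move=> /and4P[].
    * rewrite !ffunE; case: (h1 p); case: (h3 p) => *; split => //; first by lia.
      by rewrite /maxn; case: ifP.
    * move=> q npq; move: (kk p q npq); rewrite h2 // h4 // !ffunE.
      by move=> /and4P[].
  + move=> p; rewrite !ffunE; split; [exact: hm | by case: (h1 p)|].
    case: (eqVneq (g p) (minn (b p) (c p))) => [->|ne]; first by left.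
    right => q nqp; rewrite !ffunE.
    have npq : p != q by rewrite eq_sym.
    move: (kk p q npq); rewrite h2 // h4 //= => /and4P[_ _].
    by rewrite (negbTE ne).
- case=> /andP[/stripP[h1 h2] /stripP[h3 h4]] hA.
  have hm p : g p <= minn (b p) (c p) by case: (hA p); rewrite ffunE.
  have key p q (npq : p != q) :
    pair_ok true (col p) (col q) (g p) (b p) (g q) (b q) &&
    pair_ok false (col p) (col q) (g p) (c p) (g q) (c q).
    rewrite pair_ok_below //.
    move: (h2 p q npq) (h4 p q npq); rewrite !ffunE => -> -> /=.
    have nqp : q != p by rewrite eq_sym.
    apply/andP; split.
    + case: (hA p) => _ _; rewrite !ffunE => -[->|/(_ q nqp)]; rewrite ?eqxx //.
      by rewrite !ffunE => ->; rewrite orbT.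
    + case: (hA q) => _ _; rewrite !ffunE => -[->|/(_ p npq)]; rewrite ?eqxx //.
      by rewrite !ffunE => ->; rewrite orbT.
  apply/andP; split; apply/stripP; split.
  + by move=> p; case: (h1 p); case: (hA p); move: (hm p) => *; split => //; lia.
  + by move=> p q /key /andP[].
  + by move=> p; case: (h3 p); case: (hA p); move: (hm p) => *; split => //; lia.
  + by move=> p q /key /andP[].
Qed.

(* [p] and [q] are the two ends of a gap between intervals [[lo s, hi s]]. *)
Definition link b c p q : bool :=
  (hi b c p < lo b c q) &&
  [forall s, (hi b c s <= hi b c p) || (lo b c q <= lo b c s)].

Lemma linkP b c p q : reflect
  (hi b c p < lo b c q /\
   forall s, (hi b c s <= hi b c p) || (lo b c q <= lo b c s))
  (link b c p q).
Proof. by apply: (iffP andP) => -[? /forallP]. Qed.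

Lemma lo_le_hi b c p : lo b c p <= hi b c p.
Proof. by rewrite !ffunE; lia. Qed.

Lemma compat_parity b c p : compat b c ->
  [/\ odd (hi b c p) = col p & odd (lo b c p) = col p].
Proof.
case/andP => /stripP[h1 _] /stripP[h2 _]; rewrite !ffunE.
by case: (h1 p) (h2 p) => _ ? _ [_ ? _]; rewrite /maxn /minn; case: ifP.
Qed.

Lemma compat_disjoint b c p q : compat b c -> p != q -> col p = col q ->
  (hi b c p < lo b c q) || (hi b c q < lo b c p).
Proof.
case/andP => /stripP[_ h1] /stripP[_ h2] npq Epq.
move: (h1 p q npq) (h2 p q npq); rewrite Epq !ffunE /pair_ok.
by case: (col q) => /=; lia.
Qed.

(** Ends of different colours differ in parity, and intervals of one colour are disjoint. *)
Lemma hi_inj b c : compat b c -> injective (hi b c).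
Proof.
move=> cbc p q Epq; apply/eqP; apply: contraT => npq.
have Ecol : col p = col q.
  by case: (compat_parity p cbc) => <- _; case: (compat_parity q cbc) => <- _; rewrite Epq.
by have := compat_disjoint cbc npq Ecol; have := lo_le_hi b c p; have := lo_le_hi b c q; lia.
Qed.

Lemma lo_inj b c : compat b c -> injective (lo b c).
Proof.
move=> cbc p q Epq; apply/eqP; apply: contraT => npq.
have Ecol : col p = col q.
  by case: (compat_parity p cbc) => _ <-; case: (compat_parity q cbc) => _ <-; rewrite Epq.
by have := compat_disjoint cbc npq Ecol; have := lo_le_hi b c p; have := lo_le_hi b c q; lia.
Qed.

(** By injectivity of [lo], a gap has a single particle at its upper end, so a sum over linked
    particles merely selects that partner. *)
Lemma link_sum_next b c p q (F : P -> nat) : compat b c -> link b c p q ->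
  \sum_(q' | link b c p q') F q' = F q.
Proof.
move=> cbc lpq; apply: big_pred1 => q' /=; apply/idP/eqP => [lpq'|-> //].
apply: (lo_inj cbc).
case/linkP: lpq => h1 /(_ q') h2; case/linkP: lpq' => h3 /(_ q) h4.
by have := lo_le_hi b c q; have := lo_le_hi b c q'; lia.
Qed.

Lemma link_sum_prev b c p q (F : P -> nat) : compat b c -> link b c p q ->
  \sum_(p' | link b c p' q) F p' = F p.
Proof.
move=> cbc lpq; apply: big_pred1 => p' /=; apply/idP/eqP => [lpq'|-> //].
apply: (hi_inj cbc).
case/linkP: lpq => h1 /(_ p') h2; case/linkP: lpq' => h3 /(_ p) h4.
by have := lo_le_hi b c p; have := lo_le_hi b c p'; lia.
Qed.

Lemma above_link b c a p q : above b c a -> link b c p q -> a p < lo b c q.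
Proof.
move=> /(_ p)[_ _ ha] /linkP[lpq _]; case: ha => [->//|/(_ q)].
have nqp : q != p.
  by apply: contraTneq lpq => ->; rewrite -leqNgt lo_le_hi.
by move=> /(_ nqp); have := lo_le_hi b c q; lia.
Qed.

Lemma below_link b c g p q : below b c g -> link b c p q -> hi b c p < g q.
Proof.
move=> /(_ q)[_ _ hg] /linkP[lpq _]; case: hg => [->//|/(_ p)].
have npq : p != q.
  by apply: contraTneq lpq => ->; rewrite -leqNgt lo_le_hi.
by move=> /(_ npq); have := lo_le_hi b c p; lia.
Qed.

Variable p0 : P.

Definition top b c : P := [arg max_(p > p0) hi b c p].

Lemma le_top b c p : hi b c p <= hi b c (top b c).
Proof. by rewrite /top; case: arg_maxnP => // q _; apply. Qed.

Lemma link_top b c p q : link b c p q -> p != top b c.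
Proof.
case/linkP => h _; apply: contraTneq h => ->.
by rewrite -leqNgt (leq_trans (lo_le_hi _ _ _) (le_top _ _ _)).
Qed.

(** Among the intervals ending above [hi b c p], take the one that starts lowest. Since [p] really
    moves, it must stop before that start, which leaves a gap. *)
Lemma above_next b c a p : compat b c -> above b c a ->
  p != top b c -> a p != hi b c p -> exists q, link b c p q.
Proof.
move=> cbc /(_ p)[hp _ [->|ha]] ntop; first by rewrite eqxx.
move=> ne.
have Htop : hi b c p < hi b c (top b c).
  rewrite ltn_neqAle le_top andbT; apply: contra_neq ntop; exact: hi_inj.
case: (@arg_minnP _ (top b c) (fun q => hi b c p < hi b c q) (lo b c) Htop).
move=> q hq qmin; exists q; apply/linkP; split.
  have /ha : q != p by apply: contraTneq hq => ->; rewrite ltnn.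
  by move: hp; lia.
by move=> s; case: (leqP (hi b c s) (hi b c p)) => //= /qmin.
Qed.

(** The hypothesis on [p0] provides a floor: its interval starts at 0, so a particle that moves down
    must stop above [hi b c p0], and some interval lies below it. *)
Lemma below_prev b c g q : b p0 = 0 -> below b c g ->
  g q != lo b c q -> exists p, link b c p q.
Proof.
move=> b0 /(_ q)[hq _ [->|hg]]; first by rewrite eqxx.
move=> ne.
have lo0 : lo b c p0 = 0 by rewrite ffunE b0 min0n.
have H0 : hi b c p0 < lo b c q.
  have /hg : p0 != q by apply: contra_neq ne => Eq; move: hq; rewrite -Eq lo0; lia.
  by rewrite lo0 /=; move: hq; lia.
case: (@arg_maxnP _ p0 (fun p => hi b c p < lo b c q) (hi b c) H0).
move=> p hp pmax; exists p; apply/linkP; split => // s.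
case: (ltnP (hi b c s) (lo b c q)) => [/pmax h|hs]; first by apply/orP; left.
case: (eqVneq s q) => [->|/hg]; first by rewrite leqnn orbT.
by move: hs hq; lia.
Qed.

(** The distance run upwards into a gap is replayed downwards from the other end of the gap. The sum
    has at most one term; it is empty when no gap ends at [q]. *)
Definition lower b c a : {ffun P -> nat} :=
  [ffun q => lo b c q - \sum_(p | link b c p q) (a p - hi b c p)].

(** Halving loses nothing for an admissible peak: a particle keeps the parity of its colour, so its
    moves are even. *)
Definition gain b c a : nat := (a (top b c) - hi b c (top b c))./2.

(* Inverse of [a |-> (lower b c a, gain b c a)]. *)
Definition raise b c k g : {ffun P -> nat} :=
  [ffun p => hi b c p + (if p == top b c then k.*2
                         else \sum_(q | link b c p q) (lo b c q - g q))].

Lemma lower_link b c a p q : compat b c -> link b c p q ->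
  lower b c a q = lo b c q - (a p - hi b c p).
Proof. by move=> cbc lpq; rewrite ffunE (link_sum_prev _ cbc lpq). Qed.

Lemma lower_nolink b c a q : (forall p, ~~ link b c p q) ->
  lower b c a q = lo b c q.
Proof.
by move=> nl; rewrite ffunE big_pred0 ?subn0 // => p; rewrite (negbTE (nl p)).
Qed.

Lemma raise_top b c k g : raise b c k g (top b c) = hi b c (top b c) + k.*2.
Proof. by rewrite ffunE eqxx. Qed.

Lemma raise_link b c k g p q : compat b c -> link b c p q ->
  raise b c k g p = hi b c p + (lo b c q - g q).
Proof.
by move=> cbc lpq; rewrite ffunE (negbTE (link_top lpq)) (link_sum_next _ cbc lpq).
Qed.

Lemma raise_nolink b c k g p : p != top b c -> (forall q, ~~ link b c p q) ->
  raise b c k g p = hi b c p.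
Proof.
move=> np nl; rewrite ffunE (negbTE np) big_pred0 ?addn0 // => q.
by rewrite (negbTE (nl q)).
Qed.

Lemma link_prev_dec b c q : (exists p, link b c p q) \/ (forall p, ~~ link b c p q).
Proof.
case: (boolP [exists p, link b c p q]) => [/existsP|/existsPn]; by [left|right].
Qed.

Lemma link_next_dec b c p : (exists q, link b c p q) \/ (forall q, ~~ link b c p q).
Proof.
case: (boolP [exists q, link b c p q]) => [/existsP|/existsPn]; by [left|right].
Qed.

Lemma lower_below b c a : compat b c -> above b c a -> below b c (lower b c a).
Proof.
move=> cbc ha q; have [_ oq] := compat_parity q cbc.
have [[p lpq]|nl] := link_prev_dec b c q; last first.
  by rewrite lower_nolink //; split => //; left.
have [op _] := compat_parity p cbc; have apq := above_link ha lpq.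
have [hap oap _] := ha p; case/linkP: (lpq) => hpq hs.
rewrite (lower_link _ cbc lpq); split; first by lia.
  rewrite oddB; last by lia.
  by rewrite oddB // op oap oq addbb addbF.
case: (eqVneq (a p) (hi b c p)) => [->|ne]; first by left; lia.
right => s nsq; have /orP[|] := hs s; first by lia.
have : lo b c q != lo b c s by apply: contra_neq nsq => /(lo_inj cbc).
by lia.
Qed.

Lemma raise_above b c k g : compat b c -> below b c g -> above b c (raise b c k g).
Proof.
move=> cbc hg p; have [op _] := compat_parity p cbc.
case: (eqVneq p (top b c)) => [Ep|ntop].
  rewrite Ep raise_top -Ep; split; [by lia | by rewrite oddD odd_double addbF|].
  (* No interval ends above that of the top particle, so its move is unbounded. *)
  right => s nsp; apply/orP; left.
  rewrite ltn_neqAle {2}Ep le_top andbT.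
  by apply: contra_neq nsp => /(hi_inj cbc).
have [[q lpq]|nl] := link_next_dec b c p; last first.
  by rewrite raise_nolink //; split => //; left.
have [_ oq] := compat_parity q cbc; have apq := below_link hg lpq.
have [hgq ogq _] := hg q; case/linkP: (lpq) => hpq hs.
rewrite (raise_link _ _ cbc lpq); split; first by lia.
  by rewrite oddD oddB // op ogq oq addbb addbF.
case: (eqVneq (g q) (lo b c q)) => [->|ne]; first by left; lia.
right => s nsq; have /orP[|] := hs s; last by lia.
have : hi b c s != hi b c p by apply: contra_neq nsq => /(hi_inj cbc).
by lia.
Qed.

Lemma lowerK b c a : compat b c -> above b c a ->
  raise b c (gain b c a) (lower b c a) = a.
Proof.
move=> cbc ha; apply/ffunP => p; have [hap oap _] := ha p.
have [op _] := compat_parity p cbc.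
case: (eqVneq p (top b c)) => [Ep|ntop].
  rewrite Ep raise_top -Ep /gain -Ep even_halfK; first by rewrite subnKC.
  by rewrite oddB // op oap addbb.
have [[q lpq]|nl] := link_next_dec b c p.
  rewrite (raise_link _ _ cbc lpq) (lower_link _ cbc lpq).
  by have := above_link ha lpq; lia.
rewrite raise_nolink //; apply/eqP; rewrite eq_sym; apply: contraT => ne.
by have [q] := above_next cbc ha ntop ne; rewrite (negbTE (nl q)).
Qed.

Lemma raiseK b c k g : b p0 = 0 -> compat b c -> below b c g ->
  lower b c (raise b c k g) = g /\ gain b c (raise b c k g) = k.
Proof.
move=> b0 cbc hg; split; last by rewrite /gain raise_top addKn doubleK.
apply/ffunP => q; have [hgq _ _] := hg q.
have [[p lpq]|nl] := link_prev_dec b c q.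
  by rewrite (lower_link _ cbc lpq) (raise_link _ _ cbc lpq) addKn subKn.
rewrite lower_nolink //; apply/eqP; rewrite eq_sym; apply: contraT => ne.
by have [p] := below_prev b0 hg ne; rewrite (negbTE (nl p)).
Qed.

(** In each row [hi] and [lo] add up to [b] and [c]. The upward moves cancel the downward moves gap
    by gap, except for the move of the top particle. *)
Lemma sum_lower b c a : compat b c -> above b c a ->
  \sum_p a p + \sum_p lower b c a p
  = \sum_p b p + \sum_p c p + (gain b c a).*2.
Proof.
move=> cbc ha.
have Ea : \sum_p a p = \sum_p hi b c p + \sum_p (a p - hi b c p).
  by rewrite -big_split; apply: eq_bigr => p _; case: (ha p) => /= ? _ _; rewrite subnKC.
have hb := lower_below cbc ha.
have El : \sum_p lo b c p
  = \sum_p lower b c a p + \sum_p (lo b c p - lower b c a p).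
  by rewrite -big_split; apply: eq_bigr => p _; case: (hb p) => /= ? _ _; rewrite subnKC.
have Ebc : \sum_p hi b c p + \sum_p lo b c p = \sum_p b p + \sum_p c p.
  by rewrite -!big_split; apply: eq_bigr => p _ /=; rewrite !ffunE; lia.
have Et : \sum_p (a p - hi b c p)
  = (gain b c a).*2 + \sum_(p | p != top b c) (a p - hi b c p).
  rewrite (bigD1 (top b c)) //= /gain even_halfK //.
  have [h o _] := ha (top b c); have [o' _] := compat_parity (top b c) cbc.
  by rewrite oddB // o o' addbb.
have Es : \sum_q (lo b c q - lower b c a q)
  = \sum_(p | p != top b c) (a p - hi b c p).
  transitivity (\sum_q \sum_(p | link b c p q) (a p - hi b c p)).
    apply: eq_bigr => q _.
    have [[p lpq]|nl] := link_prev_dec b c q.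
      rewrite (lower_link _ cbc lpq) (link_sum_prev _ cbc lpq) subKn //.
      by have := above_link ha lpq; lia.
    by rewrite lower_nolink // subnn big_pred0 // => p; rewrite (negbTE (nl p)).
  (* Collect by the lower end of each gap: the top particle has no gap over it, and any other
     particle without a gap over it stays at [hi]. *)
  rewrite (exchange_big_dep predT) //= [RHS]big_mkcond; apply: eq_bigr => p _ /=.
  case: eqVneq => [Ep|ntop] /=.
    by rewrite big_pred0 // => q; apply: contraTF (eqxx p) => /link_top; rewrite -Ep eqxx.
  have [[q lpq]|nl] := link_next_dec b c p.
    by rewrite (link_sum_next _ cbc lpq).
  rewrite big_pred0; last by move=> q; rewrite (negbTE (nl q)).
  apply/esym/eqP; rewrite subn_eq0; apply: contraT => ne.
  have /above_next : a p != hi b c p by lia.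
  by case/(_ cbc ha ntop) => q; rewrite (negbTE (nl q)).
lia.
Qed.

End LocalMove.

(** * Chains of states and the exchange of two adjacent slices *)

Section Chains.

Variables (K : finType) (kcol : K -> bool) (n : nat).
Notation P := (K * 'I_n.+1)%type.
Notation state := {ffun K * 'I_n.+1 -> nat}.
Implicit Types (p q : P) (x y : state) (w : seq bool) (s : seq state).

Definition pcol p : bool := kcol p.1.

(** This is the empty partition in every colour. Rows are numbered from the smallest part to the
    largest. *)
Definition ground : state := [ffun p : P => p.2.*2 + kcol p.1].

(* [u] is [true] for a hole slice. *)
Definition step (u : bool) x y : bool :=
  if u then strip pcol false x y else strip pcol true y x.

Fixpoint walk x w s : bool :=
  match w, s with
  | [::], [::] => true
  | u :: w', y :: s' => step u x y && walk y w' s'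
  | _, _ => false
  end.

Definition chain w s : bool := walk ground w s && (last ground s == ground).

Definition excess x : int := ((\sum_p x p)%:Z - (\sum_p ground p)%:Z)%R.

(* All but the [m] highest rows have part 0. *)
Definition ground_below (m : nat) x : Prop :=
  forall p, p.2 + m < n.+1 -> x p = ground p.

Lemma walk_size x w s : walk x w s -> size s = size w.
Proof. by elim: w x s => [|u w IH] x [|y s] //= /andP[_ /IH ->]. Qed.

Lemma walk_cat x w1 w2 s1 s2 : size s1 = size w1 ->
  walk x (w1 ++ w2) (s1 ++ s2) = walk x w1 s1 && walk (last x s1) w2 s2.
Proof. by elim: w1 x s1 => [|u w IH] x [|y s] //= [/IH->]; rewrite andbA. Qed.

(** Intervals of one colour are disjoint, so [y] in row r stays below [x] in row r+1. If the latter
    is at ground level, parity leaves only the ground position for row r. *)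
Lemma strip_ground_above e m x y : strip pcol e x y ->
  ground_below m x -> ground_below m.+1 y.
Proof.
case/stripP => h1 h2 gx [k r] /= hr.
have hr1 : r.+1 < n.+1 by lia.
have := h2 (k, r) (k, Ordinal hr1).
have := h1 (k, r); have := h1 (k, Ordinal hr1).
rewrite /pair_ok !gx ?ffunE /pcol /=; [|lia|lia].
case=> h3 _ _ [h4 _ h5]; rewrite xpair_eqE eqxx /= -val_eqE /= => /(_ _).
by move: h3 h4 h5; case: (kcol k) => /=; lia.
Qed.

(** Row r of [x] is squeezed between the ground positions of [y] in rows r-1 and r, and parity
    decides. *)
Lemma strip_ground_below e m x y : strip pcol e x y ->
  ground_below m y -> ground_below m x.
Proof.
case/stripP => h1 h2 gy [k [[|r] hr0]] /= hr.
  have := h1 (k, Ordinal hr0); rewrite gy //= !ffunE /pcol /=.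
  by case: (kcol k) => /= -[]; lia.
have hr1 : r < n.+1 by lia.
have := h2 (k, Ordinal hr0) (k, Ordinal hr1).
have := h1 (k, Ordinal hr0); have := h1 (k, Ordinal hr1).
rewrite /pair_ok !gy ?ffunE /pcol /=; [|lia|lia].
case=> h3 _ _ [h4 h5 _]; rewrite xpair_eqE eqxx /= -val_eqE /= => /(_ _).
by move: h3 h4 h5; case: (kcol k) => /=; lia.
Qed.

Lemma ground_belowW m m' x : m <= m' -> ground_below m x -> ground_below m' x.
Proof. by move=> le_mm' gx p hp; apply: gx; lia. Qed.

Lemma ground_below0 x : ground_below 0 x -> x = ground.
Proof. by move=> gx; apply/ffunP => p; apply: gx; rewrite addn0. Qed.

Lemma ground_belowg m : ground_below m ground. Proof. by []. Qed.

Lemma walk_ground_below m x w s : walk x w s -> ground_below m x ->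
  ground_below (m + count id w) (last x s).
Proof.
elim: w x s m => [|u w IH] x [|y s] m //=; first by rewrite addn0.
case/andP => hxy /IH{}IH gx; rewrite addnA; apply: IH.
case: u hxy => /= hxy; first by rewrite addn1; exact: (strip_ground_above hxy gx).
by rewrite addn0; exact: (strip_ground_below hxy gx).
Qed.

Lemma chain_catP w1 w2 u v s :
  chain (w1 ++ [:: u, v & w2]) s <-> exists s1 y z s2,
    [/\ s = s1 ++ [:: y, z & s2], size s1 = size w1, walk ground w1 s1 &
    [/\ step u (last ground s1) y, step v y z, walk z w2 s2 & last z s2 = ground]].
Proof.
split.
  case/andP => hw /eqP hl.
  have hs := walk_size hw.
  have : size (take (size w1) s) = size w1.
    by rewrite size_takel // hs size_cat leq_addr.
  move: hw hl; rewrite -{1 2}(cat_take_drop (size w1) s).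
  set s1 := take _ _ => hw hl sz1.
  move: hw hl; rewrite walk_cat // last_cat.
  have : size (drop (size w1) s) = (size w2).+2.
    by rewrite size_drop hs size_cat /= addKn.
  case E : (drop _ _) => [|y [|z s2]] //= _ /andP[h1 /and3P[h2 h3 h4]] h5.
  by exists s1, y, z, s2; split => //; rewrite -E cat_take_drop.
case=> s1 [y [z [s2 [-> sz1 h1 [h2 h3 h4 h5]]]]].
by rewrite /chain walk_cat // h1 last_cat /= h2 h3 h4 h5 eqxx.
Qed.

Hypothesis kcol_inj : injective kcol.

Lemma strip_ground e : strip pcol e ground ground.
Proof.
apply/stripP; split => [[k r]|[k r] [k' r'] ne].
  by rewrite !ffunE /pcol /=; case: (kcol k) => /=; split; lia.
suff : ground (k, r) != ground (k', r') by rewrite neq_ltn /pair_ok => /orP[] ->; rewrite ?orbT.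
apply: contra_neq ne; rewrite !ffunE /= => E.
have Er : r = r' :> nat by move: E; case: (kcol k); case: (kcol k') => /=; lia.
have Ek : kcol k = kcol k' by move: E; rewrite Er; case: (kcol k); case: (kcol k') => /=; lia.
by rewrite (kcol_inj Ek) (val_inj Er).
Qed.

(** A particle slice cannot go below the ground state, and a hole slice that ends there must have
    started there. *)
Lemma sorted_chain (i j : nat) s :
  chain (nseq i false ++ nseq j true) s = (s == nseq (i + j) ground).
Proof.
apply/idP/eqP => [/andP[hw /eqP hl]|->]; last first.
  apply/andP; split; last by elim: (i + j).
  elim: i => [|i IH] /=; last by rewrite /step strip_ground.
  by elim: j => //= j ->; rewrite strip_ground.
elim: i s hw hl => [|i IH] [|y s] //=.
- by rewrite add0n; case: j.
- rewrite add0n => hw hl.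
  (* The hole slices are treated from the end of the chain backwards, so the starting state must be
     general. *)
  suff : forall x s, walk x (nseq j true) s -> last x s = ground ->
           x = ground /\ s = nseq j ground.
    by case/(_ ground (y :: s) hw hl).
  elim: j {hw hl} => [|j IH] x [|z t] //= /andP[hxz /IH{}IH] /IH[Ez ->].
  rewrite Ez; split => //; apply: ground_below0.
  by rewrite Ez in hxz; apply: (strip_ground_below hxz).
- case/andP => hy hw hl.
  have Ey : y = ground by apply: ground_below0; apply: (strip_ground_below hy).
  by rewrite Ey in hw hl *; rewrite (IH s).
Qed.

Variables (k0 : K) (kcol0 : kcol k0 = false).
Let p0 : P := (k0, ord0).

(** A chain does not list its initial state; [last ground (take i s)] supplies it as left neighbour
    of position 0. *)
Definition lower_at (i : nat) s : seq state * nat :=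
  let b := last ground (take i s) in
  let a := nth ground s i in let c := nth ground s i.+1 in
  (take i s ++ lower b c a :: drop i.+1 s, gain p0 b c a).

Definition raise_at (i : nat) s (k : nat) : seq state :=
  let b := last ground (take i s) in
  let g := nth ground s i in let c := nth ground s i.+1 in
  take i s ++ raise p0 b c k g :: drop i.+1 s.

Lemma lower_at_cat s1 a c s2 :
  let b := last ground s1 in
  lower_at (size s1) (s1 ++ [:: a, c & s2])
  = (s1 ++ [:: lower b c a, c & s2], gain p0 b c a).
Proof.
rewrite /lower_at take_size_cat // drop_cat ltnNge leqnSn /= subSnn /=.
by rewrite !nth_cat ltnn subnn ltnNge leqnSn subSnn.
Qed.

Lemma raise_at_cat s1 g c s2 k :
  let b := last ground s1 in
  raise_at (size s1) (s1 ++ [:: g, c & s2]) k = s1 ++ [:: raise p0 b c k g, c & s2].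
Proof.
rewrite /raise_at take_size_cat // drop_cat ltnNge leqnSn /= subSnn /=.
by rewrite !nth_cat ltnn subnn ltnNge leqnSn subSnn.
Qed.

(* The new total at position [i] is forced by those of the two neighbours. *)
Definition swap_excess (i : nat) (e : seq int) (k : nat) : seq int :=
  take i e ++ (last 0 (take i e) + nth 0 e i.+1 + (k.*2)%:Z - nth 0 e i)%R
           :: drop i.+1 e.

Lemma excess_ground : excess ground = 0%R.
Proof. by rewrite /excess GRing.subrr. Qed.

Lemma swap_excess_cat s1 b a g c s2 k : b = last ground s1 ->
  (excess a + excess g = excess b + excess c + (k.*2)%:Z)%R ->
  swap_excess (size s1) (map excess (s1 ++ [:: g, c & s2])) k
  = map excess (s1 ++ [:: a, c & s2]).
Proof.
move=> Eb Ex; rewrite /swap_excess !map_cat /= -(size_map excess s1).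
rewrite take_size_cat // drop_cat ltnNge leqnSn /= subSnn /=.
rewrite !nth_cat ltnn subnn ltnNge leqnSn subSnn /=; congr (_ ++ _ :: _).
rewrite -{1}excess_ground last_map -Eb -Ex; lia.
Qed.

Section Swap.
Variables (w1 w2 : seq bool).
Hypothesis hw1 : count id w1 <= n.
Notation w := (w1 ++ [:: true, false & w2]).
Notation w' := (w1 ++ [:: false, true & w2]).

(** Each hole slice frees at most one more row, so after at most [n] of them the bottom one of the
    [n.+1] rows still has part 0. This is the floor that [below_prev] needs. *)
Lemma ground_p0 s1 : walk ground w1 s1 -> last ground s1 p0 = 0.
Proof.
move=> h; rewrite (walk_ground_below h (@ground_belowg 0)).
  by rewrite ffunE /= kcol0.
by rewrite /= add0n.
Qed.

Lemma lower_atP s : chain w s ->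
  [/\ chain w' (lower_at (size w1) s).1,
      raise_at (size w1) (lower_at (size w1) s).1 (lower_at (size w1) s).2 = s &
      swap_excess (size w1) (map excess (lower_at (size w1) s).1)
                  (lower_at (size w1) s).2 = map excess s].
Proof.
case/chain_catP => s1 [a [c [s2 [-> <- h1 [h2 h3 h4 h5]]]]].
rewrite lower_at_cat /= raise_at_cat /=.
set b := last ground s1 in h2 *.
have [cbc ha] : compat pcol b c /\ above pcol b c a.
  by apply/aboveP/andP; split; [exact: h2 | exact: h3].
split.
- apply/chain_catP; exists s1, (lower b c a), c, s2.
  have /belowP/andP[? ?] := conj cbc (lower_below cbc ha).
  by split => //; rewrite (walk_size h1).
- by rewrite (lowerK p0 cbc ha).
- apply: swap_excess_cat => //; rewrite /excess.
  have := sum_lower p0 cbc ha.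
  set Sa := \sum_p a p; set Sl := \sum_p lower b c a p; set Sb := \sum_p b p.
  by set Sc := \sum_p c p; set Sg := \sum_p ground p; lia.
Qed.

Lemma raise_atP s k : chain w' s ->
  chain w (raise_at (size w1) s k) /\
  lower_at (size w1) (raise_at (size w1) s k) = (s, k).
Proof.
case/chain_catP => s1 [g [c [s2 [-> <- h1 [h2 h3 h4 h5]]]]].
rewrite raise_at_cat /= lower_at_cat /=.
have b0 := ground_p0 h1.
set b := last ground s1 in h2 b0 *.
have [cbc hg] : compat pcol b c /\ below pcol b c g.
  by apply/belowP/andP; split; [exact: h2 | exact: h3].
have [E1 E2] := raiseK k b0 cbc hg.
split; last by rewrite E1 E2.
apply/chain_catP; exists s1, (raise p0 b c k g), c, s2.
have /aboveP/andP[? ?] := conj cbc (raise_above p0 k cbc hg).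
by split => //; rewrite (walk_size h1).
Qed.

End Swap.

End Chains.

(** * Classification of chains by induction on the slice word *)

Fixpoint inversions (w : seq bool) : nat :=
  if w is u :: w' then u * count negb w' + inversions w' else 0.

Lemma inversions_swap w1 w2 :
  inversions (w1 ++ [:: true, false & w2])
  = (inversions (w1 ++ [:: false, true & w2])).+1.
Proof.
by elim: w1 => [|u w IH] /=; rewrite ?IH ?count_cat /=; lia.
Qed.

Lemma sorted_or_descent (w : seq bool) :
  (exists i j, w = nseq i false ++ nseq j true) \/
  (exists w1 w2, w = w1 ++ [:: true, false & w2]).
Proof.
elim: w => [|u w [[i [j ->]]|[w1 [w2 ->]]]].
- by left; exists 0, 0.
- case: u => /=; last by left; exists i.+1, j.
  case: i => [|i]; first by left; exists 0, j.+1.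
  by right; exists [::], (nseq i false ++ nseq j true).
- by right; exists (u :: w1), w2.
Qed.

(** The parameter set and its sizes are quantified before the colours: this order is what makes
    chains of one colour and of two colours comparable. *)
Theorem chain_classification (n : nat) (w : seq bool) : count id w <= n ->
  exists (X : Type) (sz : X -> seq int),
  forall (K : finType) (kcol : K -> bool) (k0 : K),
    injective kcol -> kcol k0 = false ->
    exists f : {s : seq {ffun K * 'I_n.+1 -> nat} | chain kcol w s} -> X,
      bijective f /\ forall s, sz (f s) = map (@excess K kcol n) (val s).
Proof.
have [N] := ubnP (inversions w); elim: N w => // N IH w leN hw.
have [[i [j Ew]]|[w1 [w2 Ew]]] := sorted_or_descent w.
  exists unit, (fun _ => nseq (i + j) 0%R) => K kcol k0 inj_kcol _.
  exists (fun _ => tt); split.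
    have h : chain kcol w (nseq (i + j) (ground kcol n)) by rewrite Ew sorted_chain.
    exists (fun _ => exist (fun t => chain kcol w t) _ h) => [[s hs]|[] //]; apply: val_inj => /=.
    by move: hs; rewrite Ew sorted_chain // => /eqP.
  case=> s hs /=; move: hs; rewrite Ew sorted_chain // => /eqP ->.
  by rewrite map_nseq excess_ground.
have := IH (w1 ++ [:: false, true & w2]); case.
- by move: leN; rewrite Ew inversions_swap.
- by move: hw; rewrite Ew !count_cat.
(* The new factor records the free move [gain] lost when the peak is flattened. *)
move=> X [sz HX]; exists (X * nat)%type.
exists (fun xk => swap_excess (size w1) (sz xk.1) xk.2) => K kcol k0 inj_kcol kcol0.
have [f [[g fK gK] szf]] := HX K kcol k0 inj_kcol kcol0.
have hw1 : count id w1 <= n by move: hw; rewrite Ew count_cat; lia.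
have dn (s : seq {ffun K * 'I_n.+1 -> nat}) (hs : chain kcol w s) :
    chain kcol (w1 ++ [:: false, true & w2]) (lower_at kcol k0 (size w1) s).1.
  by move: hs; rewrite Ew => /(lower_atP kcol0 hw1)[].
have up (s : seq {ffun K * 'I_n.+1 -> nat}) k (hs : chain kcol (w1 ++ [:: false, true & w2]) s) :
    chain kcol w (raise_at kcol k0 (size w1) s k).
  by rewrite Ew; have [] := raise_atP kcol0 hw1 k hs.
exists (fun s : {s | chain kcol w s} =>
  (f (exist (fun t => chain kcol (w1 ++ [:: false, true & w2]) t) _ (dn _ (valP s))),
                  (lower_at kcol k0 (size w1) (val s)).2)).
split.
  exists (fun xk => exist (fun t => chain kcol w t) _ (up _ xk.2 (valP (g xk.1)))).
    move=> [s hs]; apply: val_inj => /=; rewrite fK /=.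
    by move: hs; rewrite Ew => /(lower_atP kcol0 hw1)[].
  move=> [x k] /=.
  have E := (raise_atP kcol0 hw1 k (valP (g x))).2.
  congr pair; last exact: (congr1 snd E).
  rewrite -[RHS](gK x); congr f; apply: val_inj.
  exact: (congr1 fst E).
move=> [s hs] /=; rewrite szf /=.
by move: hs; rewrite Ew => /(lower_atP kcol0 hw1)[].
Qed.

(** A predicate closed downwards holds on an initial segment, whose length is the count. This
    converts counts of rows into thresholds. *)
Lemma count_iota_initial (a : pred nat) (m i : nat) :
  (forall i, i.+1 < m -> a i.+1 -> a i) -> i < m ->
  (i < count a (iota 0 m)) = a i.
Proof.
elim: m i => // m IH i a_init; rewrite -[in iota _ _]addn1 iotaD count_cat /= add0n addn0 => lt_im.
have {}IH j : j < m -> (j < count a (iota 0 m)) = a j.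
  by move=> hj; apply: IH => // k hk; apply: a_init; lia.
have le_c : count a (iota 0 m) <= m by rewrite -{2}(size_iota 0 m) count_size.
have full : a m -> count a (iota 0 m) = m.
  move=> am; case: (posnP m) => [E|m0]; first by rewrite E.
  have am1 : a m.-1 by apply: a_init; rewrite ?prednK.
  by have := IH m.-1; rewrite am1; lia.
case: (ltngtP i m) lt_im => [lt_im _|lt_mi|-> _].
- rewrite -(IH i lt_im); case: (boolP (a m)) => [/full|_]; last by rewrite addn0.
  by lia.
- by lia.
- by case: (boolP (a m)) => [/full|_]; lia.
Qed.

(** * The boundary of the shape: hole and particle slices *)

Section Shape.

Variable la : seq nat.
Hypothesis hla : is_partition la.

Lemma nth_part_le i j : i <= j -> nth 0 la j <= nth 0 la i.
Proof.
case/andP: hla => srt _ le_ij.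
case: (ltnP j (size la)) => hj; last by rewrite (nth_default _ hj).
have gtr : transitive geq by move=> ? ? ? /= h1 h2; apply: leq_trans h2 h1.
by have := sorted_leq_nth gtr leqnn 0 srt; apply; rewrite ?inE //; lia.
Qed.

Lemma nth_part_head i : nth 0 la i <= head 0 la.
Proof. by rewrite -nth0; apply: nth_part_le. Qed.

Definition width : nat := size la + head 0 la.

(* Slices and diagonals are numbered from the left: [t] stands for the content
   [t - size la].  [beta i] is the slice of the particle of row [i.+1]. *)
Definition beta (i : nat) : nat := nth 0 la i + size la - i.+1.

Lemma beta_lt i j : i < j -> j < size la -> beta j < beta i.
Proof. by move=> hij hj; have := nth_part_le (ltnW hij); rewrite /beta; lia. Qed.

Lemma beta_width i : i < size la -> beta i < width.
Proof. by move=> hi; have := nth_part_head i; rewrite /beta /width; lia. Qed.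

(** This counts the rows whose right end reaches diagonal [t], including rows that the diagonal
    would meet at a column below 1. It also counts the particles in slices from [t] on. *)
Definition rows_at (t : nat) : nat :=
  count (fun i => t <= beta i) (iota 0 (size la)).

Lemma rows_at_le t : rows_at t <= size la.
Proof. by rewrite (leq_trans (count_size _ _)) ?size_iota. Qed.

Lemma lt_rows_at i t : i < size la -> (i < rows_at t) = (t <= beta i).
Proof.
move=> hi; rewrite /rows_at count_iota_initial // => j hj /= h.
by have := beta_lt (ltnSn j) hj; lia.
Qed.

Lemma rows_at0 : rows_at 0 = size la.
Proof. by rewrite /rows_at count_predT size_iota. Qed.

Lemma rows_at_width : rows_at width = 0.
Proof.
case E : (rows_at width) => [|m] //.
have h0 : 0 < size la by have := rows_at_le width; lia.
by have := lt_rows_at width h0; have := beta_width h0; lia.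
Qed.

Definition hole (t : nat) : bool := rows_at t.+1 == rows_at t.

Lemma particleP t : reflect (exists2 i, i < size la & beta i = t) (~~ hole t).
Proof.
apply: (iffP idP) => [|[i hi <-]]; rewrite /hole; last first.
  have := lt_rows_at (beta i) hi; have := lt_rows_at (beta i).+1 hi.
  by rewrite leqnn ltnn; lia.
case: (ltngtP (rows_at t.+1) (rows_at t)) => // h _.
  have hi : rows_at t.+1 < size la by have := rows_at_le t; lia.
  exists (rows_at t.+1) => //.
  by have := lt_rows_at t hi; have := lt_rows_at t.+1 hi; lia.
have hi : rows_at t < size la by have := rows_at_le t.+1; lia.
by have := lt_rows_at t hi; have := lt_rows_at t.+1 hi; lia.
Qed.

(** The numbers [beta i] strictly decrease, so a slice contains at most one particle. *)
Lemma rows_atS t : rows_at t = rows_at t.+1 + ~~ hole t.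
Proof.
case: (boolP (hole t)) => [/eqP ->|]; first by rewrite addn0.
case/particleP => i hi Ei; subst t.
have := lt_rows_at (beta i) hi; have := lt_rows_at (beta i).+1 hi.
rewrite leqnn ltnn /= => h1 h2.
have h3 : i <= rows_at (beta i).+1.
  case: i hi {h1 h2} => // i hi.
  by rewrite lt_rows_at ?(ltnW hi) //; apply: beta_lt.
case: (ltnP i.+1 (size la)) => hi1.
  have := lt_rows_at (beta i) hi1; have := beta_lt (ltnSn i) hi1; lia.
by have := rows_at_le (beta i); lia.
Qed.

Lemma rows_at_ge t : size la <= t + rows_at t.
Proof.
elim: t => [|t]; first by rewrite rows_at0.
by have := rows_atS t; case: (hole t) => /=; lia.
Qed.

Lemma lt_conj_part i j : i < size la -> (i < conj_part la j) = (j <= nth 0 la i).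
Proof.
move=> hi; rewrite /conj_part -{1}(mkseq_nth 0 la) count_map.
rewrite (@count_iota_initial (preim (nth 0 la) (leq j))) // => m _ /= h.
exact: leq_trans h (nth_part_le (leqnSn m)).
Qed.

Lemma conj_part_le j : conj_part la j <= size la.
Proof. exact: count_size. Qed.

(* [particle_slices] uses the zero of the ring [nat] as default value. *)
Lemma nth0RE (i : nat) : nth 0%R la i = nth 0 la i.
Proof. by []. Qed.

Definition content (t : nat) : int := (t%:Z - (size la)%:Z)%R.

Lemma particle_slicesP d : reflect
  (exists t, [/\ t < width, ~~ hole t & d = content t]) (d \in particle_slices la).
Proof.
rewrite in_fset /=; apply: (iffP mapP) => [[i]|[t [ht /particleP[i hi Ei] ->]]].
  rewrite mem_index_iota => hi ->; have hi' : i.-1 < size la by lia.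
  exists (beta i.-1); split; first exact: beta_width.
    by apply/particleP; exists i.-1.
  by rewrite nth0RE /content /beta; lia.
exists i.+1; first by rewrite mem_index_iota; lia.
by rewrite -Ei nth0RE /content /beta /=; lia.
Qed.

Lemma hole_slicesP d : reflect
  (exists t, [/\ t < width, hole t & d = content t]) (d \in hole_slices la).
Proof.
rewrite in_fset /=; apply: (iffP mapP) => [[j]|[t [ht hol ->]]].
  rewrite mem_index_iota => hj ->; have hc := conj_part_le j.
  exists (size la + j.-1 - conj_part la j); split.
  - by rewrite /width; lia.
  - apply: contraT => /particleP[i hi]; have := lt_conj_part j hi.
    by rewrite /beta; lia.
  - by rewrite /content; lia.
move/eqP: hol => hol; have leT := rows_at_le t.
set T := rows_at t in hol leT *.
have hT : T < size la -> nth 0 la T + size la < t + T.+1.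
  by move=> h; have := lt_rows_at t h; rewrite -/T ltnn /beta; lia.
have hT1 : 0 < T -> t.+1 + T <= nth 0 la T.-1 + size la.
  move=> h; have h' : T.-1 < size la by lia.
  by have := lt_rows_at t.+1 h'; rewrite hol /beta; lia.
(* The column j is forced by j - 1 - T = [content t]; [hT] and [hT1] say that exactly the first T
   rows reach it. *)
have ET : conj_part la (t.+1 + T - size la) = T.
  have := conj_part_le (t.+1 + T - size la).
  have : 0 < T -> T.-1 < conj_part la (t.+1 + T - size la).
    by move=> h; rewrite lt_conj_part; have := hT1 h; lia.
  have : T < size la -> T >= conj_part la (t.+1 + T - size la).
    by move=> h; rewrite leqNgt lt_conj_part //; have := hT h; lia.
  by lia.
exists (t.+1 + T - size la); last by rewrite ET /content; lia.
rewrite mem_index_iota; have := nth_part_head T.-1; move: ht; rewrite /width.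
by lia.
Qed.

End Shape.

(** * Entries read along diagonals *)

Section Entries.

Variable la : seq nat.
Hypothesis hla : is_partition la.
Implicit Types (L : rpp la) (c : cell la) (i j r t : nat).

Lemma is_cell_ex i j : is_cell la i j ->
  exists c : cell la, crow c = i /\ ccol c = j.
Proof.
move=> hc; have /andP[/andP[_ hi] /andP[_ hj]] := hc.
have hi' : i < (size la).+1 by [].
have hj' : j < (head 0 la).+1 by have := nth_part_head hla i.-1; lia.
by exists (exist _ (Ordinal hi', Ordinal hj') hc).
Qed.

Lemma cell_inj c c' : crow c = crow c' -> ccol c = ccol c' -> c = c'.
Proof.
case: c => [[i j] h]; case: c' => [[i' j'] h'] /= Ei Ej; apply: val_inj => /=.
by congr pair; apply: val_inj.
Qed.

Lemma is_cell_crow c : is_cell la (crow c) (ccol c).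
Proof. exact: (valP c). Qed.

Lemma entry_cell L c : entry L (crow c) (ccol c) = L c.
Proof.
rewrite /entry; case: pickP => [c' /andP[/eqP h1 /eqP h2]|/(_ c)].
  by rewrite (cell_inj h1 h2).
by rewrite !eqxx.
Qed.

Lemma entry_out L i j : ~~ is_cell la i j -> entry L i j = 0.
Proof.
rewrite /entry; case: pickP => // c /andP[/eqP <- /eqP <-].
by rewrite is_cell_crow.
Qed.

Lemma entry_sum L i j :
  entry L i j = \sum_(c | (crow c == i) && (ccol c == j)) L c.
Proof.
case: (boolP (is_cell la i j)) => [/is_cell_ex[c [<- <-]]|nc].
  rewrite entry_cell (big_pred1 c) //.
rewrite entry_out // big_pred0 // => c; apply: contraNF nc.
by case/andP => /eqP <- /eqP <-; exact: is_cell_crow.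
Qed.

Lemma is_cellW i j i' j' : 0 < i <= i' -> 0 < j <= j' ->
  is_cell la i' j' -> is_cell la i j.
Proof.
move=> hi hj; rewrite /is_cell.
have := @nth_part_le la hla i.-1 i'.-1; lia.
Qed.

Lemma rpp_le L c c' : crow c <= crow c' -> ccol c <= ccol c' -> L c <= L c'.
Proof.
move=> hr hc.
have : is_cell la (crow c) (ccol c').
  apply: is_cellW (is_cell_crow c').
    by rewrite hr andbT; case/andP: (is_cell_crow c) => /andP[].
  by rewrite leqnn andbT; case/andP: (is_cell_crow c') => _ /andP[].
case/is_cell_ex => d [Er Ec]; case: L => /= L hL.
apply: (@leq_trans (L d)).
  by move/forallP/(_ c)/forallP/(_ d)/andP: hL => [_ /implyP]; apply; rewrite Er Ec eqxx.
by move/forallP/(_ d)/forallP/(_ c')/andP: hL => [/implyP h _]; apply: h; rewrite Er Ec hr eqxx.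
Qed.

(** Beyond the shape [entry] drops back to 0, so monotonicity can only be claimed up to a cell or a
    position on one of the axes. *)
Definition inner i j : bool := [|| i == 0, j == 0 | is_cell la i j].

Lemma entry_le L i j i' j' : i <= i' -> j <= j' -> inner i' j' ->
  entry L i j <= entry L i' j'.
Proof.
move=> hi hj hin.
case: (boolP (is_cell la i j)) => hc; last by rewrite entry_out.
have hc' : is_cell la i' j' by move: hin hc; rewrite /inner /is_cell; lia.
have [c [Ei Ej]] := is_cell_ex hc; have [c' [Ei' Ej']] := is_cell_ex hc'.
by rewrite -Ei -Ej -Ei' -Ej' !entry_cell rpp_le // ?Ei ?Ej ?Ei' ?Ej'.
Qed.

Notation n := (width la).

(* The rows of every diagonal are aligned at their top, [r = n]; truncated
   subtraction sends all positions outside the shape to row 0 or column 0. *)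
Definition drow t r : nat := r + rows_at la t - n.
Definition dcol t r : nat := drow t r + t - size la.

Lemma drow_le t r : r <= n -> drow t r <= rows_at la t.
Proof. by rewrite /drow; lia. Qed.

Lemma inner_drow t r : r <= n -> inner (drow t r) (dcol t r).
Proof.
move=> hr; rewrite /inner; case: posnP => //= i0; case: posnP => //= j0.
have hi := drow_le t hr; have hT := rows_at_le la t.
have hi' : (drow t r).-1 < size la by lia.
have := lt_rows_at hla t hi'; move: j0; rewrite /is_cell /dcol /beta; lia.
Qed.

(** On cells, [dg] and [rk] invert the coordinates [drow] and [dcol]. *)
Definition dg c : nat := ccol c + size la - crow c.
Definition rk c : nat := crow c + n - rows_at la (dg c).

Lemma crow_bounds c : [/\ 0 < crow c, crow c <= size la, 0 < ccol c,
  ccol c <= nth 0 la (crow c).-1 & ccol c <= head 0 la].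
Proof.
have /andP[/andP[? ?] /andP[? h]] := is_cell_crow c; split => //.
exact: leq_trans h (nth_part_head hla _).
Qed.

Lemma dg_bounds c : 0 < dg c < n.
Proof. by have [] := crow_bounds c; rewrite /dg /width; lia. Qed.

Lemma crow_rows c : crow c <= rows_at la (dg c).
Proof.
have [h1 h2 h3 h4 _] := crow_bounds c.
have hi : (crow c).-1 < size la by lia.
by have := lt_rows_at hla (dg c) hi; rewrite /beta /dg; lia.
Qed.

Lemma rk_le c : rk c <= n.
Proof. by have := crow_rows c; rewrite /rk; lia. Qed.

Lemma drow_rk c : drow (dg c) (rk c) = crow c.
Proof.
have := crow_rows c; have := rows_at_le la (dg c); rewrite /drow /rk.
by rewrite /width; lia.
Qed.

Lemma dcol_rk c : dcol (dg c) (rk c) = ccol c.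
Proof. by have [] := crow_bounds c; rewrite /dcol drow_rk /dg; lia. Qed.

Lemma drow_dcol_inj c t r : drow t r = crow c -> dcol t r = ccol c ->
  t = dg c /\ r = rk c.
Proof.
have [h1 h2 h3 _ _] := crow_bounds c.
rewrite /dcol => Er; rewrite Er => Ec.
have Et : t = dg c by rewrite /dg; lia.
by split => //; rewrite /rk -Et; move: Er; rewrite /drow; lia.
Qed.

(** Each cell is met once, at [dg c] and [rk c], and all other positions contribute 0. The shift to
    [t.+1] is harmless because no cell has [dg c] equal to 0. *)
Lemma volume_diag L :
  volume L = \sum_(t < n) \sum_(r < n.+1) entry L (drow t.+1 r) (dcol t.+1 r).
Proof.
under eq_bigr => t _ do under eq_bigr => r _ do rewrite entry_sum.
rewrite pair_bigA /= (exchange_big_dep predT) //=.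
apply: eq_bigr => c _.
have hd := dg_bounds c.
have hd' : (dg c).-1 < n by lia.
have hr : rk c < n.+1 by have := rk_le c; lia.
rewrite (big_pred1 (Ordinal hd', Ordinal hr)) //= => -[t r] /=.
apply/idP/eqP => [/andP[/eqP Er /eqP Ec]|[-> ->]] /=; last first.
  by rewrite prednK ?drow_rk ?dcol_rk ?eqxx //; lia.
have [Et Erk] := drow_dcol_inj (esym Er) (esym Ec).
by congr pair; apply: val_inj => //=; rewrite -Et.
Qed.

Lemma mem_diag t c : (c \in diag la (content la t)) = (t == dg c).
Proof.
rewrite mem_filter mem_enum andbT /content /dg.
by have [_ ? _ _ _] := crow_bounds c; apply/eqP/eqP; lia.
Qed.

Lemma mem_diag_row t r c :
  crow c = drow t r -> ccol c = dcol t r -> c \in diag la (content la t).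
Proof. by move=> h1 h2; rewrite mem_diag; have [->] := drow_dcol_inj (esym h1) (esym h2). Qed.

(* Across a slice, each row goes from [lo_entry] up to [hi_entry]. *)
Definition lo_entry L t r : nat :=
  if hole la t then entry L (drow t r) (dcol t r)
  else entry L (drow t.+1 r) (dcol t.+1 r).
Definition hi_entry L t r : nat :=
  if hole la t then entry L (drow t.+1 r) (dcol t.+1 r)
  else entry L (drow t r) (dcol t r).

Lemma drow_hole t r : hole la t -> drow t.+1 r = drow t r.
Proof. by move=> h; rewrite /drow [rows_at la t]rows_atS // h addn0. Qed.

Lemma drow_particle t r : ~~ hole la t -> drow t.+1 r = (drow t r).-1.
Proof. by move=> h; rewrite /drow [rows_at la t]rows_atS // h addn1; lia. Qed.

Lemma lo_le_hi_entry L t r : r <= n -> lo_entry L t r <= hi_entry L t r.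
Proof.
move=> hr; rewrite /lo_entry /hi_entry; case: ifPn => h.
  by apply: entry_le; rewrite ?inner_drow // /dcol drow_hole //; lia.
case: (posnP (drow t r)) => h0.
  by rewrite entry_out // drow_particle // h0.
by apply: entry_le; rewrite ?inner_drow // /dcol drow_particle //; lia.
Qed.

(** Interlacing of distinct rows: a slice crosses one column or one row, and passing to a higher
    rank on a diagonal increases both coordinates by at least as much. *)
Lemma hi_le_lo_entry L t r r' : r < r' -> r' <= n ->
  hi_entry L t r <= lo_entry L t r'.
Proof.
move=> hrr hr; rewrite /lo_entry /hi_entry; case: ifPn => h.
  case: (posnP (drow t r')) => h0.
    by rewrite entry_out // drow_hole // /is_cell; move: h0; rewrite /drow; lia.
  by apply: entry_le; rewrite ?inner_drow // /dcol ?drow_hole //; move: h0; rewrite /drow; lia.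
have E := drow_particle r' h.
case: (posnP (drow t r)) => h0; first by rewrite entry_out // h0.
have h1 : drow t r <= drow t.+1 r' by rewrite E; move: h0; rewrite /drow; lia.
by apply: entry_le; rewrite ?inner_drow // /dcol; lia.
Qed.

(** The faces at a cell fill the interval crossed by its row of the diagonal; ranks that correspond
    to no cell cross nothing. *)
Lemma mem_faces L t x :
  (x \in (if hole la t then left_faces (content la t) L
          else right_faces (content la t) L)) <->
  exists2 r, r <= n & lo_entry L t r + drow t r < x <= hi_entry L t r + drow t r.
Proof.
have Ect : (content la t + 1)%R = content la t.+1 by rewrite /content; lia.
rewrite /lo_entry /hi_entry; case: ifPn => h; rewrite in_fset /=.
  split.
    case/allpairsPdep => c [y [hc hy ->]]; move: hc hy.
    rewrite Ect mem_diag mem_index_iota => /eqP Et hy.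
    exists (rk c); first exact: rk_le.
    have := drow_rk c; have := dcol_rk c; rewrite -Et => hcol hrow.
    have hrow' : drow t (rk c) = crow c by rewrite -hrow drow_hole.
    have Ec : dcol t (rk c) = (ccol c).-1.
      by move: hcol; rewrite /dcol hrow hrow'; lia.
    by rewrite hrow hcol hrow' Ec; lia.
  case=> r hr hx.
  have hc : is_cell la (drow t.+1 r) (dcol t.+1 r).
    by apply: contraTT hx => /(entry_out L) ->; lia.
  have [c [Er Ec]] := is_cell_ex hc.
  have [c0 _ c1 _ _] := crow_bounds c.
  apply/allpairsPdep; exists c, (x - drow t r); split.
  - by rewrite Ect; exact: mem_diag_row Er Ec.
  - have Ec' : (ccol c).-1 = dcol t r.
      by rewrite Ec /dcol drow_hole //; lia.
    by rewrite mem_index_iota Ec' Er Ec drow_hole //; move: hx; rewrite drow_hole //; lia.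
  - by rewrite Er drow_hole //; lia.
split.
  case/allpairsPdep => c [y [hc hy ->]]; move: hc hy.
  rewrite mem_diag mem_index_iota => /eqP Et hy.
  exists (rk c); first exact: rk_le.
  have := drow_rk c; have := dcol_rk c; rewrite -Et => hcol hrow.
  have [c0 _ c1 _ _] := crow_bounds c.
  have hrow' : drow t.+1 (rk c) = (crow c).-1 by rewrite drow_particle // hrow.
  have Ec : dcol t.+1 (rk c) = ccol c.
    by move: hcol; rewrite /dcol hrow hrow'; lia.
  by rewrite hrow hcol hrow' Ec; lia.
case=> r hr hx.
have hc : is_cell la (drow t r) (dcol t r).
  by apply: contraTT hx => /(entry_out L) ->; lia.
have [c [Er Ec]] := is_cell_ex hc.
have [c0 _ c1 _ _] := crow_bounds c.
apply/allpairsPdep; exists c, (x - drow t r); split.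
- exact: mem_diag_row Er Ec.
- have Er' : (crow c).-1 = drow t.+1 r by rewrite drow_particle // Er.
  have Ec' : ccol c = dcol t.+1 r by rewrite Ec /dcol -Er' Er; lia.
  by rewrite mem_index_iota Er' {1}Ec' Er Ec; lia.
- by rewrite Er; lia.
Qed.

Lemma mem_top_faces L t x : (x \in top_faces (content la t) L) <->
  exists r, [/\ r <= n, is_cell la (drow t.+1 r) (dcol t.+1 r) &
    x = entry L (drow t.+1 r) (dcol t.+1 r) + drow t.+1 r + 1].
Proof.
have Ect : (content la t + 1)%R = content la t.+1 by rewrite /content; lia.
rewrite in_fset /= Ect; split.
  case/mapP => c; rewrite mem_diag => /eqP Et ->; exists (rk c).
  have := drow_rk c; have := dcol_rk c; rewrite -Et => -> ->.
  by split; [exact: rk_le | exact: is_cell_crow |].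
case=> r [hr hc ->]; have [c [Er Ec]] := is_cell_ex hc.
by apply/mapP; exists c; rewrite ?(mem_diag_row Er Ec) // Er Ec.
Qed.

End Entries.

(** * Coupled pairs as failures of separation *)

Section Coupling.

Variable la : seq nat.
Hypothesis hla : is_partition la.
Implicit Types (L : rpp la) (c : cell la) (i j r t : nat).
Notation n := (width la).

(** This is [pair_ok] for blue row [r] and red row [r'], written with parts. The mix of [<=] and [<]
    comes from red positions being one more than blue ones. *)
Definition separated L L' t r r' : bool :=
  [|| hi_entry L t r + r <= lo_entry L' t r' + r',
      hi_entry L' t r' + r' < lo_entry L t r + r
    | if hole la t then lo_entry L t r == hi_entry L t r
      else lo_entry L' t r' == hi_entry L' t r'].

Definition faces L t : {fset nat} :=
  if hole la t then left_faces (content la t) L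
  else right_faces (content la t) L.

Lemma moving_cell L t r : lo_entry L t r < hi_entry L t r ->
  if hole la t then is_cell la (drow la t.+1 r) (dcol la t.+1 r)
  else is_cell la (drow la t r) (dcol la t r).
Proof.
rewrite /lo_entry /hi_entry; case: ifP => _ h;
  by apply: contraLR h => /(entry_out L) ->.
Qed.

Lemma moving_row L t r : lo_entry L t r < hi_entry L t r ->
  0 < drow la t r /\ drow la t r + n = r + rows_at la t.
Proof.
move/moving_cell; suff h : 0 < drow la t r -> drow la t r + n = r + rows_at la t.
  case: ifP => hh /andP[/andP[h0 _] _]; last by split => //; apply: h.
  by rewrite drow_hole // in h0; split => //; apply: h.
by rewrite /drow; lia.
Qed.

(** Only moving rows have faces. In a hole slice the red top face sits one position past the last
    red face of its row; in a particle slice the blue top face sits one position before the first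
    blue face. Adding it to the faces gives exactly the positions that the moving row of the other
    colour must avoid. *)
Lemma separatedP L L' t :
  (forall r r', r <= n -> r' <= n -> separated L L' t r r') <->
  [/\ forall x, x \in faces L t -> x \notin faces L' t,
      hole la t -> forall x, x \in faces L t -> x \notin top_faces (content la t) L' &
      ~~ hole la t -> forall x, x \in faces L' t -> x \notin top_faces (content la t) L].
Proof.
split=> [sep|[dis dis_hole dis_part] r r' hr hr'].
  split.
  - move=> x /mem_faces[] // r hr hx; apply/negP => /mem_faces[] // r' hr' hx'.
    have [_ h1] : 0 < drow la t r /\ drow la t r + n = r + rows_at la t.
      by apply: (@moving_row L); lia.
    have [_ h2] : 0 < drow la t r' /\ drow la t r' + n = r' + rows_at la t.
      by apply: (@moving_row L'); lia.
    by have := sep r r' hr hr'; rewrite /separated; case: ifP; lia.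
  - move=> hh x /mem_faces[] // r hr hx; apply/negP => /mem_top_faces[] // r' [hr' hc Ex].
    have [_ h1] : 0 < drow la t r /\ drow la t r + n = r + rows_at la t.
      by apply: (@moving_row L); lia.
    have E : entry L' (drow la t.+1 r') (dcol la t.+1 r') = hi_entry L' t r'.
      by rewrite /hi_entry hh.
    have := sep r r' hr hr'; have := lo_le_hi_entry hla L' t hr'.
    move: Ex; rewrite E drow_hole // /separated hh.
    case/andP: hc => /andP[h0 _] _; move: h0; rewrite drow_hole // /drow; move: h1 hx.
    by rewrite /drow; lia.
  - move=> hh x /mem_faces[] // r' hr' hx'; apply/negP => /mem_top_faces[] // r [hr hc Ex].
    have [_ h1] : 0 < drow la t r' /\ drow la t r' + n = r' + rows_at la t.
      by apply: (@moving_row L'); lia.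
    have E : entry L (drow la t.+1 r) (dcol la t.+1 r) = lo_entry L t r.
      by rewrite /lo_entry (negbTE hh).
    have := sep r r' hr hr'; have := lo_le_hi_entry hla L t hr.
    move: Ex; rewrite E drow_particle // /separated (negbTE hh).
    case/andP: hc => /andP[h0 _] _; move: h0; rewrite drow_particle // /drow; move: h1 hx'.
    by rewrite /drow; lia.
apply: contraT => nsep.
have le := lo_le_hi_entry hla L t hr; have le' := lo_le_hi_entry hla L' t hr'.
move: nsep; rewrite /separated !negb_or -!ltnNge => /and3P[h1 h2 h3].
case: (boolP (hole la t)) h3 => hh h3.
- have mv : lo_entry L t r < hi_entry L t r by lia.
  have [r0 Er] := moving_row mv; have := moving_cell mv; rewrite hh => hc.
  (* If the red row ends at 0, failed separation gives [r <= r']; the red position is then no lower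
     than the moving blue cell on the same diagonal, hence a cell. *)
  have hc' : is_cell la (drow la t.+1 r') (dcol la t.+1 r').
    case: (posnP (hi_entry L' t r')) => [hi0|]; last first.
      by rewrite /hi_entry hh; apply: contraLR => /(entry_out L') ->.
    have lerr : r <= r' by lia.
    have := inner_drow hla t.+1 hr'; rewrite /inner.
    move: hc; rewrite /is_cell /dcol /drow; lia.
  have Er' : drow la t r' + n = r' + rows_at la t.
    by case/andP: hc' => /andP[h0 _] _; move: h0; rewrite drow_hole // /drow; lia.
  (* This is the first position above both lower ends: a blue face that meets a red face or, past
     the red upper end, the red top face. *)
  pose x := maxn (lo_entry L t r + drow la t r) (lo_entry L' t r' + drow la t r') + 1.
  have xL : x \in faces L t by apply/mem_faces => //; exists r => //; rewrite /x; lia.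
  case: (ltnP (hi_entry L' t r' + drow la t r') x) => hx.
    have /negP[] := dis_hole hh x xL; apply/mem_top_faces => //; exists r'; split => //.
    have -> : entry L' (drow la t.+1 r') (dcol la t.+1 r') = hi_entry L' t r'.
      by rewrite /hi_entry hh.
    by move: hx; rewrite drow_hole // /x; lia.
  have /negP[] := dis x xL; apply/mem_faces => //; exists r' => //.
  by move: hx; rewrite /x; lia.
- have mv : lo_entry L' t r' < hi_entry L' t r' by lia.
  have [r0 Er'] := moving_row mv; have := moving_cell mv; rewrite (negbTE hh) => hc'.
  have hc : is_cell la (drow la t r) (dcol la t r).
    case: (posnP (hi_entry L t r)) => [hi0|]; last first.
      by rewrite /hi_entry (negbTE hh); apply: contraLR => /(entry_out L) ->.
    have lerr : r' <= r by lia.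
    have := inner_drow hla t hr; rewrite /inner.
    move: hc'; rewrite /is_cell /dcol /drow; lia.
  have Er : drow la t r + n = r + rows_at la t.
    by case/andP: hc => /andP[h0 _] _; move: h0; rewrite /drow; lia.
  (* This is the first red face not below the blue top face: it meets that top face or a blue
     face. *)
  pose x := maxn (lo_entry L t r + drow la t r) (lo_entry L' t r' + drow la t r' + 1).
  have xL' : x \in faces L' t by apply/mem_faces => //; exists r' => //; rewrite /x; lia.
  case: (ltnP (lo_entry L t r + drow la t r) x) => hx.
    have : x \in faces L t by apply/mem_faces => //; exists r => //; move: hx; rewrite /x; lia.
    by move/dis; rewrite xL'.
  (* A blue row with [drow la t r] equal to 1 would force [x <= 1], whereas red faces start at 2. *)
  have r1 : 0 < drow la t.+1 r.
    rewrite drow_particle //; case: (ltnP 1 (drow la t r)) => [|r1]; first by lia.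
    have lo0 : lo_entry L t r = 0.
      rewrite /lo_entry (negbTE hh) entry_out // drow_particle // /is_cell.
      by move: r1; lia.
    by move: hx; rewrite /x lo0; lia.
  have hc1 : is_cell la (drow la t.+1 r) (dcol la t.+1 r).
    have := inner_drow hla t.+1 hr; rewrite /inner.
    suff : 0 < dcol la t.+1 r by lia.
    by case/andP: hc => _ /andP[]; rewrite /dcol drow_particle //; lia.
  have /negP[] := dis_part hh x xL'; apply/mem_top_faces => //; exists r; split => //.
  have -> : entry L (drow la t.+1 r) (dcol la t.+1 r) = lo_entry L t r.
    by rewrite /lo_entry (negbTE hh).
  by move: hx r1; rewrite drow_particle // /x; lia.
Qed.

Lemma fsetI_card0P (A B : {fset nat}) :
  reflect (forall x, x \in A -> x \notin B) (#|` (A `&` B)%fset| == 0).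
Proof.
rewrite cardfs_eq0; apply: (iffP eqP) => [E x xA|h].
  by apply/negP => xB; move/fsetP/(_ x): E; rewrite in_fsetI xA xB in_fset0.
by apply/fsetP => x; rewrite in_fset0 in_fsetI; apply/negP => /andP[/h/negP].
Qed.

Lemma coupled_pairs_eq0 L L' : coupled_pairs L L' = 0 <->
  forall t r r', t < n -> r <= n -> r' <= n -> separated L L' t r r'.
Proof.
split.
  move/eqP; rewrite /coupled_pairs addn_eq0 !sum_nat_seq_eq0.
  case/andP => /allP hH /allP hD t r r' ht; move: r r'.
  apply/separatedP; rewrite /faces; case: (boolP (hole la t)) => hh.
    have /hH : content la t \in hole_slices la by apply/hole_slicesP => //; exists t.
    by rewrite /= addn_eq0 => /andP[/fsetI_card0P ? /fsetI_card0P ?].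
  have /hD : content la t \in particle_slices la.
    by apply/particle_slicesP => //; exists t.
  rewrite /= addn_eq0 => /andP[/fsetI_card0P h1 /fsetI_card0P h2].
  by split => // _ x hx; apply: contraL hx => /h2.
move=> sep; apply/eqP; rewrite /coupled_pairs addn_eq0 !sum_nat_seq_eq0.
apply/andP; split; apply/allP => d.
  case/hole_slicesP => // t [ht hh ->] /=; rewrite addn_eq0.
  have [h1 h2 _] : _ := (separatedP L L' t).1 (fun r r' => sep t r r' ht).
  move: h1 (h2 hh); rewrite /faces hh => ? ?.
  by apply/andP; split; apply/fsetI_card0P.
case/particle_slicesP => // t [ht hh ->] /=; rewrite addn_eq0.
have [h1 _ h2] : _ := (separatedP L L' t).1 (fun r r' => sep t r r' ht).
move: h1 (h2 hh); rewrite /faces (negbTE hh) => ? h3.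
apply/andP; split; apply/fsetI_card0P => // x hx.
by apply: contraL hx => /h3.
Qed.

End Coupling.

Lemma walkP (K : finType) (kcol : K -> bool) (n : nat)
    (d x : {ffun K * 'I_n.+1 -> nat}) w s :
  walk kcol x w s <->
  size s = size w /\
  forall t, t < size w -> step kcol (nth false w t) (nth d (x :: s) t) (nth d s t).
Proof.
elim: w x s => [|u w IH] x [|y s] //=; try by split => // -[].
split.
  by case/andP => hxy /IH[-> h]; split => // -[|t] //= ht; apply: h.
case=> -[sz] h; rewrite (h 0) //=; apply/IH; split => // t ht.
exact: (h t.+1).
Qed.

(** * Reverse plane partitions as chains *)

Section Translation.

Variable la : seq nat.
Hypothesis hla : is_partition la.
Notation n := (width la).

Definition shape_word : seq bool := mkseq (hole la) n.

Lemma size_shape_word : size shape_word = n.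
Proof. exact: size_mkseq. Qed.

Variables (K : finType) (kcol : K -> bool).
Notation P := (K * 'I_n.+1)%type.
Notation state := {ffun K * 'I_n.+1 -> nat}.
Notation gr := (ground kcol n).

Lemma chainP (s : seq state) : chain kcol shape_word s <->
  [/\ size s = n,
      forall t, t < n -> step kcol (hole la t) (nth gr (gr :: s) t) (nth gr s t) &
      nth gr (gr :: s) n = gr].
Proof.
split=> [/andP[/(walkP _ gr)[sz h] /eqP hl]|[sz h hl]].
  move: sz; rewrite size_shape_word => sz; split => //.
    move=> t ht; have := h t; rewrite size_shape_word nth_mkseq //; exact.
  by have := last_nth gr gr s; rewrite sz hl => <-.
apply/andP; split; last by rewrite (last_nth gr) sz hl.
apply/(walkP _ gr); rewrite size_shape_word; split => // t ht.
by rewrite nth_mkseq //; apply: h.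
Qed.

Section FromRpp.
Variable Ls : K -> rpp la.

Definition slice_state t : state :=
  [ffun p : P => (entry (Ls p.1) (drow la t p.2) (dcol la t p.2)).*2 + gr p].

Definition chain_of : seq state := mkseq (fun t => slice_state t.+1) n.

Lemma slice_state0 : slice_state 0 = gr.
Proof.
apply/ffunP => p; rewrite ffunE entry_out // /is_cell /dcol.
by have := rows_at_le la 0; have := ltn_ord p.2; rewrite /drow; lia.
Qed.

Lemma slice_state_last : slice_state n = gr.
Proof.
apply/ffunP => -[k r]; rewrite ffunE entry_out // /is_cell /drow rows_at_width //=.
by have := ltn_ord r; lia.
Qed.

Lemma nth_chain_of t : t <= n -> nth gr (gr :: chain_of) t = slice_state t.
Proof.
case: t => [|t] ht /=; first by rewrite slice_state0.
by rewrite nth_mkseq.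
Qed.

Definition lo_state t : state := [ffun p : P => (lo_entry (Ls p.1) t p.2).*2 + gr p].
Definition hi_state t : state := [ffun p : P => (hi_entry (Ls p.1) t p.2).*2 + gr p].

Lemma step_slice t : step kcol (hole la t) (slice_state t) (slice_state t.+1)
  = strip (@pcol K kcol n) (~~ hole la t) (lo_state t) (hi_state t).
Proof.
rewrite /step /lo_state /hi_state /slice_state /lo_entry /hi_entry.
by case: (hole la t).
Qed.

(** Within one colour, monotonicity of the reverse plane partition already gives interlacing, so
    only pairs of different colours carry a condition. *)
Lemma strip_slice t :
  strip (@pcol K kcol n) (~~ hole la t) (lo_state t) (hi_state t) <->
  forall p q : P, p.1 != q.1 ->
    pair_ok (~~ hole la t) (kcol p.1) (kcol q.1)
      (lo_state t p) (hi_state t p) (lo_state t q) (hi_state t q).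
Proof.
split=> [/stripP[_ h] p q npq|h].
  by apply: h; apply: contra_neq npq => ->.
apply/stripP; split.
  move=> p; rewrite !ffunE /pcol; have := ltn_ord p.2; rewrite ltnS => hp.
  have := lo_le_hi_entry hla (Ls p.1) t hp.
  by case: (kcol p.1) => /=; split; lia.
move=> [k r] [k' r'] npq; case: (eqVneq k k') npq => [<-|nk _]; last exact: h.
rewrite xpair_eqE eqxx /= -val_eqE /= => nr.
have := ltn_ord r; have := ltn_ord r'; rewrite !ltnS => hr' hr.
rewrite /pair_ok !ffunE /pcol /=.
case: (ltngtP (val r) (val r')) nr => //= lt _.
  by have := hi_le_lo_entry hla (Ls k) t lt hr'; case: (kcol k) => /=; lia.
by have := hi_le_lo_entry hla (Ls k) t lt hr; case: (kcol k) => /=; lia.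
Qed.

Lemma chain_ofP : chain kcol shape_word chain_of <->
  forall t (p q : P), t < n -> p.1 != q.1 ->
    pair_ok (~~ hole la t) (kcol p.1) (kcol q.1)
      (lo_state t p) (hi_state t p) (lo_state t q) (hi_state t q).
Proof.
split=> [/chainP[_ h _] t p q ht|h].
  have := h t ht; rewrite nth_chain_of ?(ltnW ht) // nth_mkseq // step_slice.
  by move/strip_slice; apply.
apply/chainP; split; first exact: size_mkseq.
  move=> t ht; rewrite nth_chain_of ?(ltnW ht) // nth_mkseq // step_slice.
  by apply/strip_slice => p q; apply: h.
by rewrite nth_chain_of // slice_state_last.
Qed.

Lemma excess_slice t : excess kcol (slice_state t) =
  (\sum_k \sum_(r < n.+1) entry (Ls k) (drow la t r) (dcol la t r)).*2.
Proof.
rewrite pair_bigA /= /excess.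
have -> : \sum_p slice_state t p = \sum_(p : P)
    (entry (Ls p.1) (drow la t p.2) (dcol la t p.2)).*2 + \sum_p gr p.
  by rewrite -big_split /=; apply: eq_bigr => p _; rewrite ffunE.
rewrite (big_morph double doubleD double0).
by set A := \sum_p _.*2; set B := \sum_p gr p; lia.
Qed.

Lemma sum_excess_chain_of :
  (\sum_(e <- map (@excess K kcol n) chain_of) e)%R = (\sum_k volume (Ls k)).*2.
Proof.
rewrite big_map big_map.
have -> : iota 0 n = index_iota 0 n by rewrite /index_iota subn0.
rewrite big_mkord (eq_bigr _ (fun (t : 'I_n) _ => excess_slice t.+1)).
rewrite -(big_morph Posz PoszD (erefl 0%R)) -(big_morph double doubleD double0).
rewrite exchange_big /=; congr (Posz (_.*2)); apply: eq_bigr => k _.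
by rewrite volume_diag.
Qed.

End FromRpp.

Section ToRpp.
Variable s : seq state.

Definition value_at (k : K) t r : nat :=
  (nth gr (gr :: s) t (k, inord r) - gr (k, inord r))./2.

Definition raw_rpp (k : K) : {ffun cell la -> nat} :=
  [ffun c => value_at k (dg c) (rk c)].

Hypothesis hs : chain kcol shape_word s.
Let X t := nth gr (gr :: s) t.
Let x k t r := X t (k, inord r).

(** The two intervals are disjoint; knowing the order of their lower or of their upper ends settles
    which one lies below. *)
Lemma strip_inter e (y z : state) k r : strip (@pcol K kcol n) e y z -> r < n ->
  (y (k, inord r) < y (k, inord r.+1)) || (z (k, inord r) < z (k, inord r.+1)) ->
  z (k, inord r) < y (k, inord r.+1).
Proof.
case/stripP => h1 h2 hr hyz.
have ne : (k, inord r) != (k, inord r.+1) :> P.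
  by rewrite xpair_eqE eqxx /= -val_eqE /= !inordK; lia.
have [h3 _ _] := h1 (k, inord r); have [h4 _ _] := h1 (k, inord r.+1).
move: (h2 _ _ ne) hyz h3 h4; rewrite /pair_ok /pcol /=.
move: (y (k, inord r)) (y (k, inord r.+1)) (z (k, inord r)) (z (k, inord r.+1)).
by move=> y0 y1 z0 z1; case: (kcol k); case: e {h2} => /=; lia.
Qed.

Lemma chain_step t : t < n -> step kcol (hole la t) (X t) (X t.+1).
Proof. by case/chainP: hs => _ + _; apply. Qed.

Lemma chain_parity t p : t <= n -> odd (X t p) = kcol p.1.
Proof.
rewrite leq_eqVlt => /orP[/eqP ->|/chain_step].
  have -> : X n = gr by case/chainP: hs.
  by rewrite ffunE; case: (kcol p.1) => /=; lia.
by rewrite /step; case: ifP => _ /stripP[/(_ p)[]].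
Qed.

Lemma chain_sorted k t r : t <= n -> r < n -> x k t r < x k t r.+1.
Proof.
move=> ht hr; elim: t ht => [_|t IH ht].
  by rewrite /x /X /= !ffunE /= !inordK; lia.
have := chain_step ht; rewrite /step; case: ifP => _ st.
  have := strip_inter (k := k) st hr; have [h _ _] := (stripP _ _ _ _ st).1 (k, inord r.+1).
  by move=> h'; apply: leq_trans h; apply: h'; rewrite IH // ltnW.
have := strip_inter (k := k) st hr; have [h _ _] := (stripP _ _ _ _ st).1 (k, inord r).
by move=> h'; apply: leq_ltn_trans h _; apply: h'; rewrite IH ?orbT // ltnW.
Qed.

Lemma chain_ge_ground k t r : t <= n -> r <= n -> r.*2 + kcol k <= x k t r.
Proof.
move=> ht; elim: r => [|r IH] hr; have := chain_parity (k, inord _) ht => /=.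
  by move=> /(_ 0); rewrite -/(x k t 0); case: (kcol k) => /=; lia.
move=> /(_ r.+1); rewrite -/(x k t r.+1).
have := IH (ltnW hr); have := chain_sorted k ht hr; have := chain_parity (k, inord r) ht.
by rewrite -/(x k t r) /=; case: (kcol k) => /=; lia.
Qed.

Lemma value_atE k t r : t <= n -> r <= n ->
  x k t r = (value_at k t r).*2 + (r.*2 + kcol k).
Proof.
move=> ht hr; rewrite /value_at -/(X t) -/(x k t r) ffunE /= inordK //.
have := chain_ge_ground k ht hr; have := chain_parity (k, inord r) ht.
by rewrite -/(x k t r) /=; case: (kcol k) => /=; lia.
Qed.

(** Counting from the left, at most as many rows are nonzero as there are hole slices before [t];
    counting from the right, at most as many as particle slices from [t] on. The two bounds settle
    column 0 and row 0 respectively. *)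
Lemma value_at_ground k t r : t <= n -> r <= n ->
  ~~ is_cell la (drow la t r) (dcol la t r) -> value_at k t r = 0.
Proof.
move=> ht hr nc.
have fwd : ground_below kcol (t + rows_at la t - size la) (X t).
  elim: t ht {nc} => [_|t IH ht]; first by rewrite rows_at0.
  have := IH (ltnW ht); have := chain_step ht; rewrite /step.
  have := rows_atS hla t; case: ifP => /= hh ET st g.
    apply: ground_belowW (strip_ground_above st g).
    by have := rows_at_ge hla t; lia.
  by apply: ground_belowW (strip_ground_below st g); lia.
have bwd : ground_below kcol (rows_at la t) (X t).
  have [m Em] : exists m, m + t = n by exists (n - t); lia.
  elim: m t Em {ht nc fwd} => [|m IH] t Em.
    have -> : t = n by lia.
    by have -> : X n = gr by case/chainP: hs.
  have := IH t.+1; rewrite addnS -addSn => /(_ Em).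
  have lt_tn : t < n by rewrite -Em addSn ltnS leq_addl.
  have := rows_atS hla t; have := chain_step lt_tn; rewrite /step => st.
  case: ifP st => /= hh st -> g.
    by rewrite addn0; exact: (strip_ground_below st).
  by rewrite addn1; exact: (strip_ground_above st).
suff E : x k t r = gr (k, inord r) by rewrite /value_at -/(X t) -/(x k t r) E subnn.
have := inner_drow hla t hr; rewrite /inner (negbTE nc) orbF => /orP[] /eqP h0.
  apply: bwd; rewrite /= inordK //; move: h0; rewrite /drow; lia.
apply: fwd; rewrite /= inordK //; move: h0; rewrite /dcol /drow.
lia.
Qed.


Definition value (k : K) i j : nat :=
  value_at k (j + size la - i) (i + n - rows_at la (j + size la - i)).

Lemma raw_rppE k c : raw_rpp k c = value k (crow c) (ccol c).
Proof. by rewrite ffunE. Qed.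

Lemma value_bounds i j : is_cell la i j ->
  [/\ 0 < i <= size la, j + size la - i < n &
      i <= rows_at la (j + size la - i)].
Proof.
move=> /[dup] /is_cell_ex[//|c [<- <-]] hc; have [? ? _ _ _] := crow_bounds hla c.
by split; [apply/andP | case/andP: (dg_bounds hla c) | exact: crow_rows].
Qed.

(** Rows [i] and [i.+1] of one column lie on the two sides of a slice. In a hole slice their ranks
    differ by one and interlacing applies; in a particle slice the ranks agree and the direction of
    the move suffices. For [value_col] the two cases change roles. *)
Lemma value_row k i j : 0 < i -> is_cell la i.+1 j -> value k i j <= value k i.+1 j.
Proof.
move=> i0 hc; have [hi ht hT] := value_bounds hc; rewrite /value.
have -> : j + size la - i = (j + size la - i.+1).+1 by lia.
set t := j + size la - i.+1 in ht hT *.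
have ET := rows_atS hla t; have hT' := rows_at_le la t.
have hl : size la <= n by rewrite /width leq_addr.
have := chain_step ht; rewrite /step; case: ifP ET => hh /= ET st.
  have -> : i.+1 + n - rows_at la t = (i + n - rows_at la t.+1).+1 by lia.
  set r := i + n - rows_at la t.+1.
  have hr : r < n by rewrite /r; lia.
  have := strip_inter (k := k) st hr; rewrite -/(x k t.+1 r) -/(x k t r) -/(x k t r.+1).
  have := chain_sorted k (ltnW ht) hr.
  by rewrite !value_atE //; lia.
have -> : i.+1 + n - rows_at la t = i + n - rows_at la t.+1 by lia.
set r := i + n - rows_at la t.+1.
have hr : r <= n by rewrite /r; lia.
have [h _ _] := (stripP _ _ _ _ st).1 (k, inord r).
by move: h; rewrite -/(x k t.+1 r) -/(x k t r) !value_atE //; lia.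
Qed.

Lemma value_col k i j : 0 < j -> is_cell la i j.+1 -> value k i j <= value k i j.+1.
Proof.
move=> j0 hc; have [hi ht hT] := value_bounds hc; rewrite /value.
move: ht hT; have -> : j.+1 + size la - i = (j + size la - i).+1 by lia.
set t := j + size la - i => ht hT.
have ET := rows_atS hla t; have hT' := rows_at_le la t.
have hl : size la <= n by rewrite /width leq_addr.
have := chain_step (ltnW ht); rewrite /step; case: ifP ET => hh /= ET st.
  have -> : i + n - rows_at la t.+1 = i + n - rows_at la t by lia.
  set r := i + n - rows_at la t.
  have hr : r <= n by rewrite /r; lia.
  have [h _ _] := (stripP _ _ _ _ st).1 (k, inord r).
  by move: h; rewrite -/(x k t.+1 r) -/(x k t r) !value_atE //; lia.
have -> : i + n - rows_at la t.+1 = (i + n - rows_at la t).+1 by lia.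
set r := i + n - rows_at la t.
have hr : r < n by rewrite /r; lia.
have := strip_inter (k := k) st hr.
rewrite -/(x k t r) -/(x k t r.+1) -/(x k t.+1 r) -/(x k t.+1 r.+1).
have := chain_sorted k (ltnW (ltnW ht)) hr.
by rewrite !value_atE //; lia.
Qed.

Lemma value_le_row k i m j : 0 < i -> is_cell la (i + m) j ->
  value k i j <= value k (i + m) j.
Proof.
move=> i0; elim: m => [|m IH]; rewrite ?addn0 // addnS => hc.
have j0 : 0 < j by case/andP: hc => _ /andP[].
have hc' : is_cell la (i + m) j by apply: is_cellW hc => //; lia.
by apply: leq_trans (IH hc') _; apply: value_row => //; lia.
Qed.

Lemma value_le_col k i j m : 0 < j -> is_cell la i (j + m) ->
  value k i j <= value k i (j + m).
Proof.
move=> j0; elim: m => [|m IH]; rewrite ?addn0 // addnS => hc.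
have i0 : 0 < i by case/andP: hc => /andP[].
have hc' : is_cell la i (j + m) by apply: is_cellW hc => //; lia.
by apply: leq_trans (IH hc') _; apply: value_col => //; lia.
Qed.

Lemma raw_rpp_is_rpp k : is_rpp (raw_rpp k).
Proof.
apply/forallP => c; apply/forallP => c'; rewrite !raw_rppE.
have := is_cell_crow c'; have [h1 _ h2 _ _] := crow_bounds hla c.
move: (crow c) (ccol c) (crow c') (ccol c') h1 h2 => i j i' j' i0 j0 hc.
apply/andP; split; apply/implyP => /andP[].
  by move=> /subnKC Ei /eqP Ej; move: hc; rewrite -Ej -Ei; apply: value_le_row.
by move=> /eqP Ei /subnKC Ej; move: hc; rewrite -Ei -Ej; apply: value_le_col.
Qed.

Lemma entry_raw_rpp (L : rpp la) k t r : rpp_val L = raw_rpp k ->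
  t <= n -> r <= n -> entry L (drow la t r) (dcol la t r) = value_at k t r.
Proof.
move=> EL ht hr.
case: (boolP (is_cell la (drow la t r) (dcol la t r))) => hc; last first.
  by rewrite entry_out // value_at_ground.
have [//|c [Er Ec]] := is_cell_ex _ hc.
have [-> ->] := drow_dcol_inj hla (esym Er) (esym Ec).
by rewrite drow_rk // dcol_rk // entry_cell EL ffunE.
Qed.

End ToRpp.

Lemma zero_is_rpp : is_rpp ([ffun _ => 0] : {ffun cell la -> nat}).
Proof. by apply/forallP => c; apply/forallP => c'; rewrite !ffunE !implybT. Qed.

(** For a chain, [raw_rpp_is_rpp] makes [insubd] return [raw_rpp s k] itself; the total form avoids
    carrying a proof. *)
Definition rpp_of (s : seq state) (k : K) : rpp la :=
  insubd (Rpp zero_is_rpp) (raw_rpp s k).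

Lemma rpp_ofK s : chain kcol shape_word s -> chain_of (rpp_of s) = s.
Proof.
move=> hs; have /chainP[sz _ _] := hs.
apply: (@eq_from_nth _ gr); rewrite size_mkseq // => t ht.
rewrite nth_mkseq //; apply/ffunP => -[k r]; rewrite ffunE /=.
have hr : r <= n by rewrite -ltnS.
have EL : rpp_val (rpp_of s k) = raw_rpp s k.
  by apply: (insubdK (Rpp zero_is_rpp)); apply: raw_rpp_is_rpp.
rewrite (entry_raw_rpp hs EL) // ffunE /=.
by have := value_atE hs k ht hr; rewrite inord_val => ->.
Qed.

Lemma chain_ofK Ls k : rpp_of (chain_of Ls) k = Ls k.
Proof.
rewrite /rpp_of -[RHS](valKd (Rpp zero_is_rpp)); congr insubd.
apply/ffunP => c; rewrite ffunE /value_at nth_chain_of; last first.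
  by case/andP: (dg_bounds hla c) => _ /ltnW.
rewrite ffunE /= addnK doubleK inordK ?ltnS ?rk_le //.
by rewrite drow_rk // dcol_rk // entry_cell.
Qed.

Lemma eq_chain_of Ls Ls' : Ls =1 Ls' -> chain_of Ls = chain_of Ls'.
Proof.
by move=> E; apply: eq_mkseq => t; apply/ffunP => p; rewrite !ffunE E.
Qed.

End Translation.

(** * Comparison of one colour with two *)

Lemma chain_of_unit (la : seq nat) (L : rpp la) : is_partition la ->
  chain (fun _ : unit => false) (shape_word la) (chain_of (fun _ : unit => false) (fun=> L)).
Proof. by move=> hla; apply/chain_ofP => // t [[] r] [[] r']. Qed.

Definition pair_rpp (la : seq nat) (p : rpp la * rpp la) (k : bool) : rpp la :=
  if k then p.2 else p.1.

Lemma chain_of_pair (la : seq nat) (p : rpp la * rpp la) : is_partition la ->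
  chain id (shape_word la) (chain_of id (pair_rpp p))
  = (coupled_pairs p.1 p.2 == 0).
Proof.
move=> hla; apply/idP/eqP => [/(chain_ofP hla) h|/(coupled_pairs_eq0 hla) h].
  apply/(coupled_pairs_eq0 hla) => t r r' ht hr hr'.
  have := h t (false, inord r) (true, inord r') ht isT.
  rewrite /pair_ok /separated !ffunE /= !inordK //.
  by case: (hole la t) => /=; lia.
apply/(chain_ofP hla) => t [k r] [k' r'] ht nk.
have := ltn_ord r; have := ltn_ord r'; rewrite !ltnS => hr' hr.
(* Either particle may be the blue one, so separation is taken in both orders. *)
have := h t r r' ht hr hr'; have := h t r' r ht hr' hr.
move: nk; rewrite /pair_ok /separated !ffunE /=.
by case: k; case: k' => //= _; case: (hole la t) => /=; lia.
Qed.

Theorem mainTheorem2 (la : seq nat) (hla : is_partition la) (n : nat) :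
  exists f : {p : rpp la * rpp la |
                (coupled_pairs p.1 p.2 == 0) && (volume p.1 + volume p.2 == n)}
             -> {L : rpp la | volume L == n},
    bijective f.
Proof.
(* There are [width la] slices in all and one more row than that, so the bottom row stays at part
   0. *)
have szw : count id (shape_word la) <= width la.
  by rewrite (leq_trans (count_size _ _)) // size_shape_word.
have [X [sz HX]] := chain_classification szw.
pose c1 := fun _ : unit => false.
have inj1 : injective c1 by case=> -[].
have inj2 : injective (@id bool) by [].
have [f1 [[g1 f1K g1K] sz1]] := HX _ c1 tt inj1 erefl.
have [f2 [[g2 f2K g2K] sz2]] := HX _ id false inj2 erefl.
pose F1 (L : rpp la) : X := f1 (exist (fun s => chain c1 _ s) _ (chain_of_unit L hla)).
pose G1 (x : X) : rpp la := rpp_of c1 (val (g1 x)) tt.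
have F1K L : G1 (F1 L) = L by rewrite /G1 /F1 f1K; apply: (chain_ofK hla).
have G1K x : F1 (G1 x) = x.
  rewrite -[RHS]g1K; congr f1; apply: val_inj => /=.
  rewrite -[RHS](rpp_ofK hla (valP (g1 x))).
  by apply: eq_chain_of => -[].
(* The total of [sz x] is twice the volume here and twice the total volume of the pair in [wt2];
   positions are doubled parts. *)
have wt1 x : (\sum_(e <- sz x) e)%R = (volume (G1 x)).*2.
  rewrite -{1}[x]G1K sz1 /= (sum_excess_chain_of hla).
  by congr (Posz _.*2); rewrite (big_pred1 tt) // => -[].
(* The volume condition is left aside at first: the bijections with [X] cover all volumes, and [wt1]
   and [wt2] then let them restrict to volume [n]. *)
pose Q := {p : rpp la * rpp la | coupled_pairs p.1 p.2 == 0}.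
have chQ (p : Q) : chain id (shape_word la) (chain_of id (pair_rpp (val p))).
  by rewrite chain_of_pair // (valP p).
pose F2 (p : Q) : X := f2 (exist (fun s => chain id _ s) _ (chQ p)).
pose r2 (x : X) : bool -> rpp la := rpp_of id (val (g2 x)).
have r2E x : chain_of id (pair_rpp (r2 x false, r2 x true)) = val (g2 x).
  rewrite -[RHS](rpp_ofK hla (valP (g2 x))).
  by apply: eq_chain_of => -[].
have cr2 x : coupled_pairs (r2 x false, r2 x true).1 (r2 x false, r2 x true).2 == 0.
  by rewrite -chain_of_pair // r2E; apply: valP.
pose G2 (x : X) : Q := exist (fun p => coupled_pairs p.1 p.2 == 0) _ (cr2 x).
have F2K p : G2 (F2 p) = p.
  apply: val_inj; rewrite /= /r2 /F2 f2K /= !(chain_ofK hla).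
  by case: (p) => -[].
have G2K x : F2 (G2 x) = x.
  by rewrite -[RHS]g2K; congr f2; apply: val_inj; apply: r2E.
have wt2 p : (\sum_(e <- sz (F2 p)) e)%R = (volume (val p).1 + volume (val p).2).*2.
  rewrite sz2 /= (sum_excess_chain_of hla); congr (Posz _.*2).
  by rewrite (bigD1 false) //= (big_pred1 true) // => -[].
have to_vol (p : {p : rpp la * rpp la |
    (coupled_pairs p.1 p.2 == 0) && (volume p.1 + volume p.2 == n)}) :
  {q : Q | val q = val p}.
  by case: p => p /= /andP[hp _]; exists (exist _ p hp).
have vol_f p : volume (G1 (F2 (sval (to_vol p)))) == n.
  have := wt1 (F2 (sval (to_vol p))); rewrite wt2 (svalP (to_vol p)).
  by case/andP: (valP p) => _ /eqP -> [] /double_inj <-.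
have vol_g (L : {L : rpp la | volume L == n}) :
    let p := val (G2 (F1 (val L))) in
    (coupled_pairs p.1 p.2 == 0) && (volume p.1 + volume p.2 == n).
  apply/andP; split; first exact: (valP (G2 _)).
  have := wt2 (G2 (F1 (val L))); rewrite G2K wt1 F1K => -[] /double_inj <-.
  exact: (valP L).
exists (fun p => exist (fun L => volume L == n) _ (vol_f p)).
exists (fun L => exist (fun p : rpp la * rpp la =>
  (coupled_pairs p.1 p.2 == 0) && (volume p.1 + volume p.2 == n)) _ (vol_g L)).
  move=> p; apply: val_inj => /=; rewrite G1K.
  exact: (etrans (congr1 val (F2K _)) (svalP (to_vol p))).
move=> L; apply: val_inj; rewrite /=.
set q := sval _; have -> : q = G2 (F1 (val L)).
  by apply: val_inj; rewrite /q (svalP (to_vol _)).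
by rewrite G2K F1K.
Qed.
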